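(* Let $\mathbb{G}=\mathbb{Z}_{\mathsf m_1}\times\cdots\times\mathbb{Z}_{\mathsf m_n}$ with $\mathsf m_i\mid\mathsf m_{i+1}$, $\Phi$ an abelian $3$-cocycle on $\mathbb{G}$ of the form $\Phi_{\underline{\mathbf a}}$, $G=\mathbb{Z}_{\mathsf m_1^2}\times\cdots\times\mathbb{Z}_{\mathsf m_n^2}$ and $\pi:G\to\mathbb{G}$ the canonical epimorphism. For any Nichols algebra $\mathcal{B}(V)\in{}^{\mathbb{G}}_{\mathbb{G}}\mathcal{YD}^\Phi$ (of diagonal type, with support group $\mathbb{G}$), the Nichols algebra $\mathcal{B}(\widetilde V)\in{}^G_G\mathcal{YD}^{\pi^*(\Phi)}$ is isomorphic to $\mathcal{B}(V)$. Moreover, $\mathcal{B}(\widetilde V)$ is twist equivalent to a usual Nichols algebra.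
   Context: $\mathbf{k}$ is algebraically closed of characteristic zero, $\zeta_m$ a primitive $m$-th root of unity, $[x]$ the integer part; $\mathsf g_i$, $g_i$ generate the $i$-th factors of $\mathbb{G}$, $G$; $\pi(g_i)=\mathsf g_i$; $\iota:\mathbb{G}\to G$, $\prod\mathsf g_i^{r_i}\mapsto\prod g_i^{r_i}$ ($0\le r_i<\mathsf m_i$), a set-theoretic section. For integers $0\le a_l<\mathsf m_l$, $0\le a_{st}<\gcd(\mathsf m_s,\mathsf m_t)$ ($s<t$), the abelian $3$-cocycles $\Phi_{\underline{\mathbf a}}$ are $\Phi_{\underline{\mathbf a}}(\prod\mathsf g_l^{i_l},\prod\mathsf g_l^{j_l},\prod\mathsf g_l^{k_l})=\prod_l\zeta_{\mathsf m_l}^{a_li_l[\frac{j_l+k_l}{\mathsf m_l}]}\prod_{s<t}\zeta_{\mathsf m_t}^{a_{st}i_t[\frac{j_s+k_s}{\mathsf m_s}]}$ for $0\le i_l,j_l,k_l<\mathsf m_l$. $\pi^*(\Phi)(g,h,z)=\Phi(\pi(g),\pi(h),\pi(z))$. For a finite abelian group $H$ and normalized $3$-cocycle $\Phi$ put $\widetilde\Phi_g(e,f)=\frac{\Phi(g,e,f)\Phi(e,f,g)}{\Phi(e,g,f)}$. An object of ${}^H_H\mathcal{YD}^\Phi$ is an $H$-graded space $V=\bigoplus_g{}^gV$ (coaction $\delta_L(v)=g\otimes v$) with maps $e\triangleright:{}^gV\to{}^gV$ ($1\triangleright v=v$), $e\triangleright(f\triangleright v)=\widetilde\Phi_g(e,f)(ef)\triangleright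 v$. Tensor products: degrees multiply, $x\triangleright(u\otimes v)=\widetilde\Phi_x(g,h)x\triangleright u\otimes x\triangleright v$ for degrees $g,h$; associativity $(u\otimes v)\otimes w\mapsto\Phi(e,f,g)^{-1}u\otimes(v\otimes w)$; braiding $u\otimes v\mapsto e\triangleright v\otimes u$ ($u,v,w$ of degrees $e,f,g$). $V$ (finite-dimensional) is diagonal if each ${}^gV$ is a direct sum of one-dimensional projective representations; a canonical basis $X_1,\dots,X_l$ takes one nonzero vector from each; the support group is generated by its degrees. $\mathcal{B}(V)=T_\Phi(V)/I$, with $T_\Phi(V)$ the tensor algebra in the category (Hopf algebra with $V$ primitive), $I$ the unique maximal graded Hopf ideal generated by homogeneous elements of degree $\ge2$. It is $\mathbb{Z}^l$-graded with $\deg X_i=e_i$. Two Nichols algebras $\mathcal{B}(V)$, $\mathcal{B}(U)$ over possibly different groups and cocycles, with $\dim V=\dim U=l$, are isomorphic if there is a $\mathbb{Z}^l$-graded linear isomorphism $\mathcal{B}(V)\to\mathcal{B}(U)$ preserving multiplication and comultiplication. $\widetilde V$ is the space $V$ with coaction $(\iota\otimes\mathrm{id})\delta_L$ and $G$-action $g\blacktriangleright Z=\pi(g)\triangleright Z$; it is an object of ${}^G_G\mathcal{YD}^{\pi^*(\Phi)}$. A usual Nichols algebra is one in ${}^G_G\mathcal{YD}$ (trivial cocycle). For a $2$-cochain $J:G\times G\to\mathbf{k}^*$ and a usual $\mathcal{B}(U)$, the twist $\mathcal{B}(U)^J$ is the Hopf algebra in ${}^G_G\mathcal{YD}^{\partial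 J}$ with multiplication $X\circ Y=J(x,y)XY$ ($x,y$ the degrees), isomorphic to $\mathcal{B}(U^J)$, where $U^J$ has action $g\triangleright_JX=\frac{J(g,x)}{J(x,g)}g\triangleright X$; $\mathcal{B}(U)$ and $\mathcal{B}(U)^J$ are called twist equivalent. *)

(* Defs.v *)
(* {malg K[S]} (multinomials) serves as the free K-module on the choiceType S. *)
From HB Require Import structures.
From mathcomp Require Import all_boot all_order all_algebra all_fingroup.
From mathcomp Require Import gproduct.
From mathcomp Require Import boolp.
From mathcomp Require Import finmap monalg zify.

Set Implicit Arguments.
Unset Strict Implicit.
Unset Printing Implicit Defensive.

Import GRing.Theory.
Local Open Scope ring_scope.

Section LinearExtension.
Variables (K : fieldType) (S : choiceType) (W : lmodType K).
Implicit Types (f : S -> W) (x : {malg K[S]}).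

Definition lin_ext f x : W := \sum_(s <- msupp x) x@_s *: f s.

Lemma lin_extEw f x (d : {fset S}) :
  (msupp x `<=` d)%fset -> lin_ext f x = \sum_(s <- d) x@_s *: f s.
Proof.
move=> le; rewrite /lin_ext (big_fset_incl _ le) //= => s _ /mcoeff_outdom ->.
by rewrite scale0r.
Qed.

Lemma lin_ext_is_linear f : linear (lin_ext f).
Proof.
move=> c x y; pose d := (msupp (c *: x + y) `|` msupp x `|` msupp y)%fset.
rewrite !(@lin_extEw _ _ d) /d.
- rewrite scaler_sumr -big_split; apply: eq_bigr => s _ /=.
  by rewrite mcoeffD mcoeffZ scalerDl scalerA.
- by rewrite fsubsetUr.
- by rewrite -fsetUA fsetUCA fsubsetUl.
- by rewrite -fsetUA fsubsetUl.
Qed.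

HB.instance Definition _ f :=
  GRing.isLinear.Build K {malg K[S]} W *:%R (lin_ext f) (lin_ext_is_linear f).

Lemma lin_extU f s : lin_ext f << s >> = f s.
Proof.
rewrite /lin_ext (msuppU s (1 : K)) oner_eq0 big_seq_fset1.
by rewrite mcoeffUU scale1r.
Qed.

Lemma malg_ext (f g : {malg K[S]} -> W) :
  linear f -> linear g -> (forall s, f << s >> = g << s >>) -> f =1 g.
Proof.
move=> fL gL fg x.
pose F := HB.pack_for {linear {malg K[S]} -> W} f
            (GRing.isLinear.Build _ _ _ _ f fL).
pose G := HB.pack_for {linear {malg K[S]} -> W} g
            (GRing.isLinear.Build _ _ _ _ g gL).
rewrite -[f]/(F : _ -> _) -[g]/(G : _ -> _) (monalgE x) !linear_sum.
apply: eq_bigr => s _.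
have -> : << x@_s *g s >> = x@_s *: (<< s >> : {malg K[S]}).
  by apply/malgP => t; rewrite mcoeffZ !mcoeffU mulrnAr mulr1.
by rewrite !linearZ /= fg.
Qed.

End LinearExtension.

Section Quotient.
Variables (K : fieldType) (V : lmodType K).
Implicit Types (P W : V -> Prop).

Definition submod W : Prop :=
  W 0 /\ forall c x y, W x -> W y -> W (c *: x + y).

Definition lspan P x : Prop :=
  forall W, submod W -> (forall y, P y -> W y) -> W x.

Lemma lspan_submod P : submod (lspan P).
Proof.
split=> [W [] // | c x y Px Py W sW PW]; case: (sW) => _; apply.
  exact: Px.
exact: Py.
Qed.

Lemma lspan_incl P x : P x -> lspan P x.
Proof. by move=> Px W _; apply. Qed.

Definition in_lspan P : {pred V} := fun x => `[< lspan P x >].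

Lemma in_lspan_zmod P : zmod_closed (in_lspan P).
Proof.
have [P0 PD] := lspan_submod P; split; first exact/asboolP.
move=> x y /asboolP Px /asboolP Py; apply/asboolP.
by rewrite addrC -scaleN1r; apply: PD.
Qed.

HB.instance Definition _ P :=
  GRing.isZmodClosed.Build V (in_lspan P) (in_lspan_zmod P).

(* The quotient of V by the linear span of P. *)
Definition modquot P := Quotient.quot [the zmodClosed V of in_lspan P].
HB.instance Definition _ P := GRing.Zmodule.on (modquot P).

Definition mproj P (x : V) : modquot P := \pi_(modquot P)%qT x.
Definition mrepr P (x : modquot P) : V := generic_quotient.repr x.

Lemma mreprK P (x : modquot P) : mproj P (mrepr x) = x.
Proof. exact: reprK. Qed.

Lemma mproj_eq P x y : mproj P x = mproj P y <-> lspan P (x - y).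
Proof.
split=> [/eqP | Pxy]; last apply/eqP.
  by rewrite /mproj -Quotient.idealrBE => /asboolP.
by rewrite /mproj -Quotient.idealrBE; apply/asboolP.
Qed.

Lemma mprojB P : {morph mproj P : x y / x - y}.
Proof. by move=> x y; rewrite /mproj !piE. Qed.

Lemma mprojD P : {morph mproj P : x y / x + y}.
Proof. by move=> x y; rewrite /mproj !piE. Qed.

Definition modquot_scale P c (x : modquot P) : modquot P :=
  mproj P (c *: mrepr x).

Lemma mprojZ P c x : mproj P (c *: x) = modquot_scale c (mproj P x).
Proof.
apply/mproj_eq; rewrite -scalerBr.
have [P0 PD] := lspan_submod P; rewrite -[_ *: _]addr0; apply: PD => //.
by apply/mproj_eq; rewrite mreprK.
Qed.

Lemma modquot_scaleA P a b (x : modquot P) :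
  modquot_scale a (modquot_scale b x) = modquot_scale (a * b) x.
Proof. by rewrite -(mreprK x) -!mprojZ scalerA. Qed.

Lemma modquot_scale1 P : left_id 1 (@modquot_scale P).
Proof. by move=> x; rewrite -(mreprK x) -!mprojZ scale1r. Qed.

Lemma modquot_scaleDr P : right_distributive (@modquot_scale P) +%R.
Proof.
by move=> a x y; rewrite -(mreprK x) -(mreprK y) -mprojD -!mprojZ -mprojD scalerDr.
Qed.

Lemma modquot_scaleDl P (x : modquot P) :
  {morph (@modquot_scale P)^~ x : a b / a + b}.
Proof. by move=> a b; rewrite -(mreprK x) -!mprojZ -mprojD scalerDl. Qed.

HB.instance Definition _ P := GRing.Zmodule_isLmodule.Build K (modquot P)
  (@modquot_scaleA P) (@modquot_scale1 P) (@modquot_scaleDr P)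
  (@modquot_scaleDl P).

Lemma mproj_is_linear P : linear (mproj P).
Proof. by move=> c x y; rewrite mprojD mprojZ. Qed.

HB.instance Definition _ P :=
  GRing.isLinear.Build K V (modquot P) *:%R (mproj P) (mproj_is_linear P).

Lemma mproj_eq0 P x : mproj P x = 0 <-> lspan P x.
Proof. by rewrite -(linear0 (mproj P)) mproj_eq subr0. Qed.

End Quotient.

Lemma lspan_stable (K : fieldType) (V V' : lmodType K)
    (P : V -> Prop) (W : V' -> Prop) (f : V -> V') :
  linear f -> submod W -> (forall y, P y -> W (f y)) ->
  forall y, lspan P y -> W (f y).
Proof.
move=> fL [W0 WD] PW y Py; apply: (Py (fun x => W (f x))) => //.
split=> [|c u v Wu Wv]; last first.
  by rewrite fL; apply: WD.
by have := fL (-1) 0 0; rewrite scaler0 addr0 scaleN1r addNr => ->.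
Qed.

Lemma lspan_mono (K : fieldType) (V : lmodType K) (P Q : V -> Prop) :
  (forall y, P y -> Q y) -> forall y, lspan P y -> lspan Q y.
Proof. by move=> PQ y Py W sW QW; apply: Py => // z /PQ/QW. Qed.

Section Tensor.
Variables (K : fieldType) (A B : lmodType K).

Inductive bilin_rel : {malg K[(A * B)%type]} -> Prop :=
| BilinL c a a' b :
    bilin_rel (<< (c *: a + a', b) >> - c *: << (a, b) >> - << (a', b) >>)
| BilinR c a b b' :
    bilin_rel (<< (a, c *: b + b') >> - c *: << (a, b) >> - << (a, b') >>).

Definition tens : lmodType K := modquot bilin_rel.

Definition tpure (a : A) (b : B) : tens := mproj bilin_rel << (a, b) >>.

Definition bilinear_map (W : lmodType K) (f : A -> B -> W) : Prop :=
  (forall b, linear (f^~ b)) /\ (forall a, linear (f a)).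

(* The linear map on the tensor product induced by a bilinear map. *)
Definition tens_lift (W : lmodType K) (f : A -> B -> W) (t : tens) : W :=
  lin_ext (fun p => f p.1 p.2) (mrepr t).

Lemma tpure_bilinear : bilinear_map tpure.
Proof.
split=> [b c a a' | a c b b']; rewrite /tpure; apply/eqP;
  rewrite -subr_eq0 opprD addrA -linearZ -!linearB; apply/eqP;
  apply/mproj_eq0; apply: lspan_incl.
  exact: BilinL.
exact: BilinR.
Qed.

Section Lift.
Variables (W : lmodType K) (f : A -> B -> W).
Hypothesis f_bilin : bilinear_map f.

Lemma tens_lift_proj x :
  tens_lift f (mproj bilin_rel x) = lin_ext (fun p => f p.1 p.2) x.
Proof.
case: f_bilin => fl fr; apply/eqP; rewrite -subr_eq0 /tens_lift -linearB.
pose N y := lin_ext (fun p => f p.1 p.2) y = 0.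
have sN : submod N.
  split=> [|c y z Ny Nz]; first exact: linear0.
  by rewrite /N lin_ext_is_linear [lin_ext _ y]Ny [lin_ext _ z]Nz scaler0 addr0.
apply/eqP; have /mproj_eq/(_ N sN) := mreprK (mproj bilin_rel x); apply.
by move=> _ [c a a' b | c a b b']; rewrite /N !linearB linearZ /= !lin_extU /=
  ?fl ?fr addrAC addrK subrr.
Qed.

Lemma tens_lift_linear : linear (tens_lift f).
Proof.
move=> c s t; rewrite -(mreprK s) -(mreprK t) -linearP.
by rewrite !tens_lift_proj linearP.
Qed.

Lemma tens_liftE a b : tens_lift f (tpure a b) = f a b.
Proof. by rewrite tens_lift_proj lin_extU. Qed.

End Lift.

Lemma tens_ext (W : lmodType K) (f g : tens -> W) :
  linear f -> linear g -> (forall a b, f (tpure a b) = g (tpure a b)) ->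
  f =1 g.
Proof.
move=> fL gL fg t; rewrite -(mreprK t).
have pL h : linear h -> linear (fun x => h (mproj bilin_rel x) : W).
  by move=> hL c x y; rewrite linearP hL.
apply: (malg_ext (pL _ fL) (pL _ gL)) => -[a b]; exact: fg.
Qed.

End Tensor.

Notation "a \ox b" := (tpure a b) (at level 40, left associativity).

Definition tens_map (K : fieldType) (A B A' B' : lmodType K)
    (f : A -> A') (g : B -> B') : tens A B -> tens A' B' :=
  tens_lift (fun a b => f a \ox g b).

Section TensMap.
Variables (K : fieldType) (A B A' B' : lmodType K).
Variables (f : A -> A') (g : B -> B') (fL : linear f) (gL : linear g).

Lemma tens_map_bilin : bilinear_map (fun a b => f a \ox g b).
Proof.
have [tl tr] := tpure_bilinear A' B'.
by split=> [b | a] c x y; rewrite ?fL ?gL ?tl ?tr.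
Qed.

Lemma tens_mapE a b : tens_map f g (a \ox b) = f a \ox g b.
Proof. exact: (tens_liftE tens_map_bilin). Qed.

Lemma tens_map_linear : linear (tens_map f g).
Proof. exact: tens_lift_linear tens_map_bilin. Qed.

End TensMap.

Section YetterDrinfeld.
Variables (K : fieldType) (H : finGroupType) (Phi : H -> H -> H -> K).

(* The function written \widetilde\Phi_g(e, f). *)
Definition tPhi (g e f : H) : K := Phi g e f * Phi e f g / Phi e g f.

Record ydMod := YdMod {
  yd_space :> vectType K;
  yd_comp : H -> {vspace yd_space};
  yd_act : H -> 'End(yd_space);
  yd_comp_direct : directv (\sum_g yd_comp g)%VS;
  yd_comp_full : (\sum_g yd_comp g)%VS = fullv;
  yd_act_comp : forall e g, (yd_act e @: yd_comp g <= yd_comp g)%VS;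
  yd_act1 : forall v, yd_act 1%g v = v;
  yd_actM : forall e f g v, v \in yd_comp g ->
    yd_act e (yd_act f v) = tPhi g e f *: yd_act (e * f)%g v }.

(* A basis of homogeneous vectors spanning one-dimensional projective
   subrepresentations; V is of diagonal type iff it has one. *)
Record canonical_basis (V : ydMod) (l : nat) := CanonicalBasis {
  cb_vec : 'I_l -> V;
  cb_deg : 'I_l -> H;
  cb_char : 'I_l -> H -> K;
  cb_basis : basis_of fullv [tuple cb_vec i | i < l];
  cb_homog : forall i, cb_vec i \in yd_comp V (cb_deg i);
  cb_act : forall i e, yd_act V e (cb_vec i) = cb_char i e *: cb_vec i }.

Definition support_group (V : ydMod) l (X : canonical_basis V l) : {set H} :=
  <<[set cb_deg X i | i : 'I_l]>>%g.

End YetterDrinfeld.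

Section BraidedProduct.
Variables (K : fieldType) (H : finGroupType) (Phi : H -> H -> H -> K).
Variables (A : lmodType K) (pr act : H -> A -> A) (mul : A -> A -> A).

(* The associativity constraint (u v) w |-> u (v w) acts by Phi^-1, so this is
   the scalar of the rebracketings (A B)(C D) -> A (B (C D)) -> A ((B C) D)
   and A ((C B) D) -> A (C (B D)) -> (A C)(B D). *)
Definition braid_coef (a b c d : H) : K :=
  Phi b c d * Phi a c (b * d)%g / (Phi a b (c * d)%g * Phi c b d).

(* The product (a \ox b)(c \ox d) = a (b |> c) \ox b d of the algebra
   A \ox A in the braided category; pr g is the projection onto degree g. *)
Definition tens_mul (s t : tens A A) : tens A A :=
  tens_lift (fun a b => tens_lift (fun c d =>
    \sum_(g1 : H) \sum_(g2 : H) \sum_(g3 : H) \sum_(g4 : H)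
      braid_coef g1 g2 g3 g4 *:
        (mul (pr g1 a) (act g2 (pr g3 c)) \ox mul (pr g2 b) (pr g4 d))) t) s.

End BraidedProduct.

(* The data of a Z^l-graded Hopf algebra in a category of Yetter-Drinfeld
   modules over H; hdeg g is the projection onto the component of degree g,
   and hgr v is the component of Z^l-degree v. *)
Record ydHopf (K : fieldType) (H : finGroupType) (l : nat) := YdHopf {
  hcar :> lmodType K;
  hdeg : H -> hcar -> hcar;
  hact : H -> hcar -> hcar;
  hone : hcar;
  hmul : hcar -> hcar -> hcar;
  hcounit : hcar -> K;
  hcomul : hcar -> tens hcar hcar;
  hanti : hcar -> hcar;
  hgr : 'rV[int]_l -> hcar -> Prop }.

Section TensorAlgebra.
Variables (K : fieldType) (H : finGroupType) (Phi : H -> H -> H -> K).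
Variables (l : nat) (d : 'I_l -> H) (chi : 'I_l -> H -> K).

(* Generators X_i of degree d i, with e |> X_i = chi i e *: X_i.
   A word [:: i1; ...; ir] stands for the right-bracketed monomial
   X_i1 (X_i2 (... X_ir)). *)
Definition talg : lmodType K := {malg K[seq 'I_l]}.

Definition tword (w : seq 'I_l) : talg := << w >>.

Definition wdeg (w : seq 'I_l) : H := (\prod_(i <- w) d i)%g.

Definition wmdeg (w : seq 'I_l) : 'rV[int]_l := \sum_(i <- w) delta_mx 0 i.

Fixpoint wchar (e : H) (w : seq 'I_l) : K :=
  if w is i :: w' then tPhi Phi e (d i) (wdeg w') * chi i e * wchar e w'
  else 1.

(* tword u * tword v = wcoef u v *: tword (u ++ v), by rebracketing
   (X_i u) v = Phi(deg X_i, deg u, deg v)^-1 X_i (u v). *)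
Fixpoint wcoef (u v : seq 'I_l) : K :=
  if u is i :: u' then (Phi (d i) (wdeg u') (wdeg v))^-1 * wcoef u' v else 1.

Definition t_deg (g : H) : talg -> talg :=
  lin_ext (fun w => if wdeg w == g then tword w else 0).

Definition t_len (r : nat) : talg -> talg :=
  lin_ext (fun w => if size w == r then tword w else 0).

Definition t_act (e : H) : talg -> talg :=
  lin_ext (fun w => wchar e w *: tword w).

Definition t_mul (x y : talg) : talg :=
  lin_ext (fun u => lin_ext (fun v => wcoef u v *: tword (u ++ v)) y) x.

Definition t_counit (x : talg) : K := mcoeff [::] x.

Fixpoint w_comul (w : seq 'I_l) : tens talg talg :=
  if w is i :: w' then
    tens_mul Phi t_deg t_act t_mul
      (tword [:: i] \ox tword [::] + tword [::] \ox tword [:: i]) (w_comul w')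
  else tword [::] \ox tword [::].

Definition t_comul : talg -> tens talg talg := lin_ext w_comul.

(* S(X_i w) = (deg X_i |> S(w)) S(X_i) and S(X_i) = - X_i. *)
Fixpoint w_anti (w : seq 'I_l) : talg :=
  if w is i :: w' then - t_mul (t_act (d i) (w_anti w')) (tword [:: i])
  else tword [::].

Definition t_anti : talg -> talg := lin_ext w_anti.

Definition tensor_hopf : ydHopf K H l :=
  @YdHopf K H l talg t_deg t_act (tword [::]) t_mul t_counit t_comul t_anti
    (fun v x => forall w, w \in msupp x -> wmdeg w = v).

End TensorAlgebra.

Section HopfIdeal.
Variables (K : fieldType) (H : finGroupType) (l : nat) (A : ydHopf K H l).
Implicit Types (J S : A -> Prop).

Definition two_sided_ideal J : Prop :=
  submod J /\ forall x y, J x -> J (hmul x y) /\ J (hmul y x).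

Definition gen_ideal S x : Prop :=
  forall J, two_sided_ideal J -> (forall y, S y -> J y) -> J x.

(* A Hopf ideal in the category, hence a graded submodule. *)
Record hopf_ideal J : Prop := HopfIdeal {
  hi_ideal : two_sided_ideal J;
  hi_deg : forall g x, J x -> J (hdeg g x);
  hi_act : forall g x, J x -> J (hact g x);
  hi_counit : forall x, J x -> hcounit x = 0;
  hi_comul : forall x, J x ->
    lspan (fun t => exists a b, (J a \/ J b) /\ t = a \ox b) (hcomul x);
  hi_anti : forall x, J x -> J (hanti x) }.

End HopfIdeal.

Section TensorAlgebraLinearity.
Variables (K : fieldType) (H : finGroupType) (Phi : H -> H -> H -> K).
Variables (l : nat) (d : 'I_l -> H) (chi : 'I_l -> H -> K).

Lemma t_mul_bilinear : bilinear_map (t_mul Phi d).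
Proof.
split=> [y | x] c u v; first exact: linearP.
rewrite /t_mul scaler_sumr -big_split; apply: eq_bigr => w _ /=.
by rewrite linearP scalerDr !scalerA mulrC.
Qed.

End TensorAlgebraLinearity.

Section NicholsAlgebra.
Variables (K : fieldType) (H : finGroupType) (Phi : H -> H -> H -> K).
Variables (l : nat) (d : 'I_l -> H) (chi : 'I_l -> H -> K).

Local Notation T := (tensor_hopf Phi d chi).
Implicit Types (J S : T -> Prop) (x y : T).

Definition gen_degree_ge2 J : Prop :=
  exists S, (forall y, S y -> exists2 r, (2 <= r)%N & t_len r y = y) /\
            (forall x, J x <-> gen_ideal S x).

Definition admissible_ideal J : Prop :=
  [/\ hopf_ideal J, forall r x, J x -> J (t_len r x) & gen_degree_ge2 J].

Definition in_admissible x : Prop := exists2 J, admissible_ideal J & J x.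

(* The sum of all admissible ideals; by nichols_ideal_max it is the greatest
   admissible ideal. *)
Definition nichols_ideal : T -> Prop := lspan in_admissible.

Lemma admissible_sub J : admissible_ideal J ->
  forall x, J x -> nichols_ideal x.
Proof. by move=> aJ x Jx; apply: lspan_incl; exists J. Qed.

Lemma nichols_ideal_stable (f : T -> T) : linear f ->
  (forall J, admissible_ideal J -> forall x, J x -> J (f x)) ->
  forall x, nichols_ideal x -> nichols_ideal (f x).
Proof.
move=> fL fJ; apply: lspan_stable => //; first exact: lspan_submod.
by move=> y [J aJ Jy]; apply: (admissible_sub aJ); apply: fJ.
Qed.

Lemma nichols_ideal_two_sided : two_sided_ideal nichols_ideal.
Proof.
have [ml mr] := t_mul_bilinear Phi d.
split=> [|x y Nx]; first exact: lspan_submod.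
by split; [apply: (nichols_ideal_stable (ml y)) Nx
          |apply: (nichols_ideal_stable (mr y)) Nx];
  by move=> J [[[_ idJ] _ _ _ _ _] _ _] z Jz; have [] := idJ z y Jz.
Qed.

Lemma nichols_ideal_hopf : hopf_ideal nichols_ideal.
Proof.
split.
- exact: nichols_ideal_two_sided.
- move=> g; apply: nichols_ideal_stable => [|J [[]]] *; last by auto.
  exact: linearP.
- move=> g; apply: nichols_ideal_stable => [|J [[]]] *; last by auto.
  exact: linearP.
- move=> x Nx; apply: (Nx (fun x => hcounit x = 0)) => [|y [J [[]]]]; last first.
    by move=> *; auto.
  split=> [|c u v] /=; first exact: mcoeff0.
  by rewrite /t_counit mcoeffD mcoeffZ => -> ->; rewrite mulr0 addr0.
- apply: lspan_stable => [c u v||y [J aJ Jy]]; first exact: linearP.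
    exact: lspan_submod.
  have [[_ _ _ _ cJ _] _ _] := aJ.
  apply: lspan_mono (cJ y Jy) => _ [a [b [Jab ->]]]; exists a, b; split=> //.
  by case: Jab => Jx; [left | right]; apply: (admissible_sub aJ).
- apply: nichols_ideal_stable => [|J [[]]] *; last by auto.
  exact: linearP.
Qed.

Lemma gen_ideal_submod S : submod (gen_ideal S).
Proof.
split=> [J [[] //]|c x y Sx Sy J iJ SJ].
by case: (iJ) => -[_ +] _; apply; [apply: Sx | apply: Sy].
Qed.

Lemma nichols_ideal_max :
  admissible_ideal nichols_ideal /\
  forall J, admissible_ideal J -> forall x, J x -> nichols_ideal x.
Proof.
split; last exact: admissible_sub.
split; first exact: nichols_ideal_hopf.
  move=> r; apply: nichols_ideal_stable => [|J [_ + _]]; last exact.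
  exact: linearP.
exists (fun y => in_admissible y /\ exists2 r, (2 <= r)%N & t_len r y = y).
split=> [y [] // | x]; split=> [Nx | gx].
  apply: Nx => [|y [J aJ Jy]]; first exact: gen_ideal_submod.
  have [_ _ [S [S2 SJ]]] := aJ.
  move=> J' iJ' SJ'; apply: (proj1 (SJ y) Jy J' iJ') => z Sz; apply: SJ'.
  split; last exact: S2.
  by exists J => //; apply/SJ => J'' _; apply.
apply: gx => [|y [Py _]]; first exact: nichols_ideal_two_sided.
exact: lspan_incl.
Qed.

Definition nichols_space : lmodType K := modquot in_admissible.

Definition nichols_proj : T -> nichols_space := mproj in_admissible.

(* The operations are computed on representatives; the lemmas after this
   definition show that nichols_proj commutes with all of them. *)
Definition nichols_hopf : ydHopf K H l :=
  @YdHopf K H l nichols_space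
    (fun g (q : nichols_space) => nichols_proj (hdeg g (mrepr q)))
    (fun g (q : nichols_space) => nichols_proj (hact g (mrepr q)))
    (nichols_proj (hone T))
    (fun q q' : nichols_space => nichols_proj (hmul (mrepr q) (mrepr q')))
    (fun q : nichols_space => @hcounit _ _ _ T (mrepr q))
    (fun q : nichols_space => tens_map nichols_proj nichols_proj (hcomul (mrepr q)))
    (fun q : nichols_space => nichols_proj (hanti (mrepr q)))
    (fun v (q : nichols_space) => exists2 t, hgr v t & q = nichols_proj t).

Lemma nichols_repr x : nichols_ideal (mrepr (nichols_proj x) - x).
Proof. by apply/mproj_eq; rewrite mreprK. Qed.

Lemma nichols_proj_stable (f : T -> T) : linear f ->
  (forall x, nichols_ideal x -> nichols_ideal (f x)) ->
  forall x, nichols_proj (f (mrepr (nichols_proj x))) = nichols_proj (f x).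
Proof.
move=> fL fN x; apply/mproj_eq; have /fN := nichols_repr x.
by rewrite addrC -scaleN1r fL scaleN1r addrC.
Qed.

Lemma nichols_degE g x :
  hdeg g (nichols_proj x : nichols_hopf) = nichols_proj (hdeg g x).
Proof.
apply: nichols_proj_stable; first exact: linearP.
exact: hi_deg nichols_ideal_hopf g.
Qed.

Lemma nichols_actE g x :
  hact g (nichols_proj x : nichols_hopf) = nichols_proj (hact g x).
Proof.
apply: nichols_proj_stable; first exact: linearP.
exact: hi_act nichols_ideal_hopf g.
Qed.

Lemma nichols_antiE x :
  hanti (nichols_proj x : nichols_hopf) = nichols_proj (hanti x).
Proof.
apply: nichols_proj_stable; first exact: linearP.
exact: hi_anti nichols_ideal_hopf.
Qed.

Lemma nichols_mulE x y :
  hmul (nichols_proj x : nichols_hopf) (nichols_proj y) =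
  nichols_proj (hmul x y).
Proof.
have [ml mr] := t_mul_bilinear Phi d; have [_ iN] := nichols_ideal_two_sided.
transitivity (nichols_proj (hmul x (mrepr (nichols_proj y)))).
  apply: (nichols_proj_stable (ml _)) => z Nz.
  by have [] := iN z (mrepr (nichols_proj y)) Nz.
by apply: (nichols_proj_stable (mr _)) => z Nz; have [] := iN z x Nz.
Qed.

Lemma nichols_counitE x :
  hcounit (nichols_proj x : nichols_hopf) = hcounit x.
Proof.
apply/eqP; rewrite -subr_eq0; apply/eqP.
have := hi_counit nichols_ideal_hopf (nichols_repr x).
by rewrite /= /t_counit mcoeffB.
Qed.

Lemma nichols_comulE x :
  hcomul (nichols_proj x : nichols_hopf) =
  tens_map nichols_proj nichols_proj (hcomul x).
Proof.
have pL : linear nichols_proj by exact: linearP.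
have tL := tens_map_linear pL pL.
apply/eqP; rewrite -subr_eq0 [X in X == _]addrC -scaleN1r -tL /= scaleN1r addrC.
rewrite /t_comul -linearB; apply/eqP.
have := hi_comul nichols_ideal_hopf (nichols_repr x).
move/(_ (fun t => tens_map nichols_proj nichols_proj t = 0)); apply.
  split=> [|c s t s0 t0]; last by rewrite tL s0 t0 scaler0 addr0.
  by have := tL (-1) 0 0; rewrite scaler0 addr0 scaleN1r addNr.
have [tpl tpr] := tpure_bilinear nichols_space nichols_space.
have t0l (b : nichols_space) : (0 : nichols_space) \ox b = 0.
  by have := tpl b (-1) 0 0; rewrite scaler0 addr0 scaleN1r addNr.
have t0r (a : nichols_space) : a \ox (0 : nichols_space) = 0.
  by have := tpr a (-1) 0 0; rewrite scaler0 addr0 scaleN1r addNr.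
by move=> _ [a [b [[/mproj_eq0 Na | /mproj_eq0 Nb] ->]]];
  rewrite tens_mapE // /nichols_proj ?Na ?Nb ?t0l ?t0r.
Qed.

End NicholsAlgebra.

(* B(V), with its Z^l-grading given by the canonical basis X. *)
Definition nichols (K : fieldType) (H : finGroupType) (Phi : H -> H -> H -> K)
    (V : ydMod Phi) (l : nat) (X : canonical_basis V l) : ydHopf K H l :=
  nichols_hopf Phi (cb_deg X) (cb_char X).

Section Isomorphism.
Variables (K : fieldType) (l : nat).

Definition graded_hopf_iso (H H' : finGroupType)
    (A : ydHopf K H l) (B : ydHopf K H' l) (f : {linear A -> B}) : Prop :=
  [/\ bijective f,
      forall v x, hgr v x <-> hgr v (f x),
      {morph f : x y / hmul x y} &
      forall x, hcomul (f x) = tens_map f f (hcomul x)].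

Definition graded_hopf_isomorphic (H H' : finGroupType)
    (A : ydHopf K H l) (B : ydHopf K H' l) : Prop :=
  exists f : {linear A -> B}, graded_hopf_iso f.

(* Isomorphism of Z^l-graded Hopf algebras in one category of
   Yetter-Drinfeld modules: compatible with coaction and action as well. *)
Definition yd_hopf_isomorphic (H : finGroupType) (A B : ydHopf K H l) : Prop :=
  exists f : {linear A -> B},
    [/\ graded_hopf_iso f,
        forall g, {morph f : x / hdeg g x} &
        forall g, {morph f : x / hact g x}].

End Isomorphism.

Section Twist.
Variables (K : fieldType) (G : finGroupType) (J : G -> G -> K).

Definition two_cochain : Prop :=
  [/\ forall g h, J g h != 0, forall g, J 1%g g = 1 & forall g, J g 1%g = 1].

Definition coboundary (x y z : G) : K :=
  J y z * J x (y * z)%g / (J (x * y)%g z * J x y).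

(* The image of A under the monoidal functor given by J: the product of x
   and y of degrees g and h becomes J g h *: x y, and the coproduct is
   rescaled by the inverse. *)
Definition twist (l : nat) (A : ydHopf K G l) : ydHopf K G l :=
  @YdHopf K G l A
    (@hdeg _ _ _ A)
    (fun g x => \sum_(h : G) (J g h / J h g) *: hact g (hdeg h x))
    (hone A)
    (fun x y => \sum_(g : G) \sum_(h : G)
       J g h *: hmul (hdeg g x) (hdeg h y))
    (@hcounit _ _ _ A)
    (fun x => \sum_(g : G) \sum_(h : G)
       (J g h)^-1 *: tens_map (hdeg g) (hdeg h) (hcomul x))
    (@hanti _ _ _ A)
    (@hgr _ _ _ A).

End Twist.

Definition trivial_cocycle (K : fieldType) (G : finGroupType) : G -> G -> G -> K :=
  fun _ _ _ => 1.

(* A, a Hopf algebra in the category over G with associator Phi, is twist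
   equivalent to a usual Nichols algebra. *)
Definition twist_equivalent_to_usual (K : fieldType) (G : finGroupType)
    (Phi : G -> G -> G -> K) (l : nat) (A : ydHopf K G l) : Prop :=
  exists J : G -> G -> K,
    [/\ two_cochain J,
        forall x y z, coboundary J x y z = Phi x y z &
        exists (U : ydMod (trivial_cocycle K (G:=G)))
               (Y : canonical_basis U l),
          yd_hopf_isomorphic A (twist J (nichols Y))].

Section Pullback.
Variables (K : fieldType) (G H : finGroupType) (Phi : H -> H -> H -> K).
Variables (p : G -> H) (s : H -> G).
Hypotheses (pM : {morph p : x y / (x * y)%g}) (sK : cancel s p).

Definition pullback (x y z : G) : K := Phi (p x) (p y) (p z).

Variable V : ydMod Phi.

Definition pull_comp (g : G) : {vspace V} :=
  (\sum_(h | s h == g) yd_comp V h)%VS.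

Definition pull_act (g : G) : 'End(V) := yd_act V (p g).

Lemma pull_compE g :
  pull_comp g = if s (p g) == g then yd_comp V (p g) else 0%VS.
Proof.
rewrite /pull_comp; case: eqP => [sg | sg].
  rewrite (big_pred1 (p g)) // => h /=.
  by apply/eqP/eqP=> [<- | ->]; rewrite ?sK.
by rewrite big_pred0 // => h; apply/eqP => hg; case: sg; rewrite -hg sK.
Qed.

Lemma pull_sum : (\sum_g pull_comp g = \sum_h yd_comp V h)%VS.
Proof. by rewrite [RHS](partition_big s xpredT). Qed.

Lemma pull_direct C : C =1 pull_comp -> directv (\sum_g C g)%VS.
Proof.
move=> CE; have := yd_comp_direct V; rewrite !directvE /=.
rewrite (eq_bigr _ (fun g _ => CE g)) pull_sum => /eqP->; apply/eqP.
rewrite (partition_big s xpredT) //=; apply: eq_bigr => g _.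
rewrite CE pull_compE; case: eqP => [sg | sg].
  rewrite (big_pred1 (p g)) // => h /=.
  by apply/eqP/eqP=> [<- | ->]; rewrite ?sK.
rewrite big_pred0 ?dimv0 // => h.
by apply/eqP => hg; case: sg; rewrite -hg sK.
Qed.

Lemma pull_full : (\sum_g pull_comp g)%VS = fullv.
Proof. by rewrite pull_sum yd_comp_full. Qed.

Lemma pull_act_comp e g : (pull_act e @: pull_comp g <= pull_comp g)%VS.
Proof.
by rewrite pull_compE; case: eqP => _; rewrite ?yd_act_comp ?limg0.
Qed.

Lemma pull_act1 v : pull_act 1%g v = v.
Proof.
rewrite /pull_act; suff -> : p 1%g = 1%g by rewrite yd_act1.
by apply: (mulgI (p 1%g)); rewrite -pM !mulg1.
Qed.

Lemma pull_actM e f g v : v \in pull_comp g ->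
  pull_act e (pull_act f v) =
  tPhi pullback g e f *: pull_act (e * f)%g v.
Proof.
rewrite pull_compE /pull_act pM; case: eqP => _; first exact: yd_actM.
by rewrite memv0 => /eqP ->; rewrite !linear0.
Qed.

(* \widetilde V: coaction composed with the section s, action through p. *)
Definition pull_yd : ydMod pullback :=
  YdMod (pull_direct (frefl _)) pull_full pull_act_comp pull_act1 pull_actM.

Variables (l : nat) (X : canonical_basis V l).

Lemma pull_homog i : cb_vec X i \in yd_comp pull_yd (s (cb_deg X i)).
Proof. by rewrite /= pull_compE sK eqxx cb_homog. Qed.

Lemma pull_basis_act i e : yd_act pull_yd e (cb_vec X i) =
  cb_char X i (p e) *: cb_vec X i.
Proof. exact: (cb_act X i (p e)). Qed.

Definition pull_basis : canonical_basis pull_yd l :=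
  @CanonicalBasis K G pullback pull_yd l (cb_vec X) (fun i => s (cb_deg X i))
    (fun i e => cb_char X i (p e)) (cb_basis X) pull_homog pull_basis_act.

End Pullback.

Section CyclicProducts.
Variables (n : nat) (m : 'I_n -> nat).

(* Z_{m_1} x ... x Z_{m_n}, for positive m_i: the elements of 'I_k.-1.+1 are
   the residues modulo k. *)
Definition zprod : finGroupType := {dffun forall i : 'I_n, 'I_(m i).-1.+1}.

End CyclicProducts.

Definition msq n (m : 'I_n -> nat) (i : 'I_n) : nat := (m i ^ 2)%N.

Section CanonicalEpi.
Variables (n : nat) (m : 'I_n -> nat).

Definition zproj (g : zprod (msq m)) : zprod m := [ffun i => inZp (g i)].

Definition zsec (h : zprod m) : zprod (msq m) := [ffun i => inZp (h i)].

Lemma zsecK : cancel zsec zproj.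
Proof.
move=> h; apply/ffunP => i; rewrite !ffunE; apply: val_inj => /=.
have lt_h := ltn_ord (h i); rewrite (@modn_small (h i)) ?modn_small //.
by apply: leq_trans lt_h _; rewrite ltnS /msq; case: (m i) => // k; nia.
Qed.

Lemma zprojM : {morph zproj : x y / (x * y)%g}.
Proof.
move=> x y; apply/ffunP => i; rewrite !ffunE; apply: val_inj => /=.
rewrite modnDml modnDmr modn_dvdm // /msq.
by case: (m i) => [|k] //; rewrite !prednK ?expn_gt0 // dvdn_exp.
Qed.

End CanonicalEpi.

(* \Phi_{\underline{a}}; zeta k is the chosen primitive k-th root of unity,
   and b s t is a_{st}. *)
Definition abelian_cocycle (K : fieldType) (zeta : nat -> K) (n : nat)
    (m : 'I_n -> nat) (a : 'I_n -> nat) (b : 'I_n -> 'I_n -> nat)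
    (x y z : zprod m) : K :=
  (\prod_(i < n) zeta (m i) ^+ (a i * x i * ((y i + z i) %/ m i))) *
  (\prod_(s < n) \prod_(t < n | (s < t)%N)
     zeta (m t) ^+ (b s t * x t * ((y s + z s) %/ m s))).

Definition tilde_yd (K : fieldType) (n : nat) (m : 'I_n -> nat)
    (Phi : zprod m -> zprod m -> zprod m -> K) (V : ydMod Phi) :
    ydMod (pullback Phi (@zproj n m)) :=
  pull_yd (@zprojM n m) (@zsecK n m) V.

Definition tilde_basis (K : fieldType) (n : nat) (m : 'I_n -> nat)
    (Phi : zprod m -> zprod m -> zprod m -> K) (V : ydMod Phi) (l : nat)
    (X : canonical_basis V l) : canonical_basis (tilde_yd V) l :=
  pull_basis (@zprojM n m) (@zsecK n m) X.

(* Main.v *)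
(* For G = Z_{m_1^2} x ... x Z_{m_n^2}, the pullback of Phi to G is the
   coboundary of the cochain J given by
     J(x, y) = prod_l xi_l^(- a_l x_l (y_l mod m_l))
               prod_{s<t} xi_st^(- a_st x_t (y_s mod m_s))
   with xi_l^{m_l} = zeta_{m_l} and xi_st^{m_s} = zeta_{m_t}. Dividing the
   action on \widetilde V by J(g, x) / J(x, g) gives a Yetter-Drinfeld module
   U with trivial associator, and the diagonal rescaling
   X_i w |-> J(deg X_i, deg w) X_i w of words turns the tensor algebra of V,
   or of \widetilde V, into the J-twist of the tensor algebra of U.

   The Nichols ideals correspond under this rescaling because they are
   homogeneous for the Z^l-grading: the components of an admissible ideal span
   an admissible ideal, the structure constants relating both sides are
   constant on multidegrees, and so are the degrees in the abelian groups. *)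
Require Import Defs.
From HB Require Import structures.
From mathcomp Require Import all_boot all_order all_algebra all_fingroup.
From mathcomp Require Import boolp finmap monalg ring.

Set Implicit Arguments.
Unset Strict Implicit.
Unset Printing Implicit Defensive.

Import GRing.Theory.
Local Open Scope ring_scope.

(** * Linear maps and tensor products *)

(** The squares in $G$ are explained by $J$. A root $\xi$ with $\xi^{m_s}=\zeta_{m_t}$ has order
    dividing $m_s m_t$, hence dividing $m_t^2$, but in general not $m_t$: the power $\xi^{x_t}$
    makes sense for $x_t$ in $\mathbb{Z}_{m_t^2}$ and in general not for $x_t$ in
    $\mathbb{Z}_{m_t}$. The residue of $y_s$ modulo $m_s$ is not additive in $y_s$, and the carry is
    what $\Phi$ records. The obstacle is that an admissible ideal is stable under the grading and
    the action of its own group only. Words of equal degree in $\mathbb{G}$ may have different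
    degrees in $G$, the section being in general no homomorphism, so an ideal of one side need not
    even be graded for the other. Multidegrees mediate between the two, because they decide the
    degree in every abelian group. One comparison, stated over two unrelated groups, is used twice:
    along $\pi$ for $\mathcal{B}(V)$ and along the identity of $G$ for $\mathcal{B}(\widetilde
    V)$. *)

Section LinearMaps.
Variables (K : fieldType).

Lemma linear_lincomb (V W : lmodType K) (f : V -> W) : linear f ->
  forall (I : Type) (r : seq I) (k : I -> K) (x : I -> V),
  f (\sum_(i <- r) k i *: x i) = \sum_(i <- r) k i *: f (x i).
Proof.
move=> fL I r k x; elim: r => [|i r IH]; rewrite ?(big_nil, big_cons).
  by have := fL (-1) 0 0; rewrite scaler0 addr0 scaleN1r addNr.
by rewrite fL IH.
Qed.

Lemma linear_lincomb2 (V W : lmodType K) (f : V -> W) : linear f ->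
  forall (I I' : finType) (k : I -> I' -> K) (x : I -> I' -> V),
  f (\sum_i \sum_j k i j *: x i j) = \sum_i \sum_j k i j *: f (x i j).
Proof.
move=> fL I I' k x; have := linear_lincomb fL (index_enum I) (fun=> 1)
  (fun i => \sum_j k i j *: x i j).
under eq_bigr => i _ do rewrite scale1r.
by move=> ->; apply: eq_bigr => i _; rewrite scale1r linear_lincomb.
Qed.

Lemma linear_map0 (V W : lmodType K) (f : V -> W) : linear f -> f 0 = 0.
Proof.
by move=> fL; have := fL (-1) 0 0; rewrite scaler0 addr0 scaleN1r addNr.
Qed.

Lemma linear_mapZ (V W : lmodType K) (f : V -> W) : linear f ->
  forall k x, f (k *: x) = k *: f x.
Proof. by move=> fL k x; rewrite -[_ *: x]addr0 fL linear_map0 // addr0. Qed.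

Lemma linear_mapD (V W : lmodType K) (f : V -> W) : linear f ->
  {morph f : x y / x + y}.
Proof. by move=> fL x y; rewrite -[x in LHS]scale1r fL scale1r. Qed.

Lemma linear_mapB (V W : lmodType K) (f : V -> W) : linear f ->
  {morph f : x y / x - y}.
Proof. by move=> fL x y; rewrite -scaleN1r addrC fL scaleN1r addrC. Qed.

Lemma submodZ (V : lmodType K) (P : V -> Prop) : submod P ->
  forall k x, P x -> P (k *: x).
Proof. by move=> [P0 PD] k x Px; rewrite -[_ *: x]addr0; apply: PD. Qed.

Lemma submodD (V : lmodType K) (P : V -> Prop) : submod P ->
  forall x y, P x -> P y -> P (x + y).
Proof. by move=> [P0 PD] x y Px Py; rewrite -[x]scale1r; apply: PD. Qed.

Lemma submod_sum (V : lmodType K) (P : V -> Prop) : submod P ->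
  forall (I : Type) (r : seq I) (x : I -> V), (forall i, P (x i)) ->
  P (\sum_(i <- r) x i).
Proof.
move=> sP I r x Px; elim/big_ind: _ => //; [by case: sP | exact: submodD].
Qed.

Lemma submod_preim (V W : lmodType K) (P : W -> Prop) (f : V -> W) :
  linear f -> submod P -> submod (fun x => P (f x)).
Proof.
move=> fL [P0 PD]; split=> [|k x y Px Py]; first by rewrite linear_map0.
by rewrite fL; apply: PD.
Qed.

Lemma malg_ind (S : choiceType) (P : {malg K[S]} -> Prop) :
  submod P -> (forall s, P << s >>) -> forall x, P x.
Proof.
move=> sP PU x; rewrite (monalgE x); apply: submod_sum => // s.
have -> : << x@_s *g s >> = x@_s *: (<< s >> : {malg K[S]}).
  by apply/malgP => t; rewrite mcoeffZ !mcoeffU mulrnAr mulr1.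
exact: submodZ.
Qed.

Lemma lin_ext_fun_linear (S : choiceType) (V W : lmodType K)
    (g : V -> S -> W) x :
  (forall s, linear (g^~ s)) -> linear (fun a => lin_ext (g a) x).
Proof.
move=> gL k a a'; rewrite /lin_ext scaler_sumr -big_split.
apply: eq_bigr => s _ /=.
by rewrite gL scalerDr !scalerA mulrC.
Qed.

Lemma tens_lift_fun_linear (A B V W : lmodType K) (g : V -> A -> B -> W) t :
  (forall a b, linear (fun v => g v a b)) ->
  linear (fun v => tens_lift (g v) t).
Proof. by move=> gL; apply: lin_ext_fun_linear => -[a b]; exact: gL. Qed.

Lemma tens_lift_bilin2 (A B C D W : lmodType K) (g : A -> B -> C -> D -> W) :
  (forall b c d, linear (fun a => g a b c d)) ->
  (forall a c d, linear (fun b => g a b c d)) ->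
  forall t, bilinear_map (fun a b => tens_lift (g a b) t).
Proof.
move=> g1 g2 t; split=> [b|a]; apply: (tens_lift_fun_linear (g := fun x => _)).
  by move=> c d; exact: g1.
by move=> c d; exact: g2.
Qed.

Lemma tpureZl (A B : lmodType K) k (a : A) (b : B) :
  (k *: a) \ox b = k *: (a \ox b).
Proof. exact: (linear_mapZ ((tpure_bilinear A B).1 b)). Qed.
Lemma tpureZr (A B : lmodType K) k (a : A) (b : B) :
  a \ox (k *: b) = k *: (a \ox b).
Proof. exact: (linear_mapZ ((tpure_bilinear A B).2 a)). Qed.
Lemma tpure0l (A B : lmodType K) (b : B) : (0 : A) \ox b = 0.
Proof. exact: (linear_map0 ((tpure_bilinear A B).1 b)). Qed.
Lemma tpure0r (A B : lmodType K) (a : A) : a \ox (0 : B) = 0.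
Proof. exact: (linear_map0 ((tpure_bilinear A B).2 a)). Qed.

Lemma sum_linear (I : finType) (V W : lmodType K) (f : I -> V -> W) :
  (forall i, linear (f i)) -> linear (fun x => \sum_i f i x).
Proof.
move=> fL k x y; rewrite scaler_sumr -big_split; apply: eq_bigr => i _.
exact: fL.
Qed.

Lemma scale_linear (V W : lmodType K) (f : V -> W) k :
  linear f -> linear (fun x => k *: f x).
Proof. by move=> fL c x y; rewrite fL scalerDr !scalerA mulrC. Qed.

Lemma comp_linear (V W X : lmodType K) (f : W -> X) (g : V -> W) :
  linear f -> linear g -> linear (fun x => f (g x)).
Proof. by move=> fL gL k x y; rewrite gL fL. Qed.

Lemma submod_eq (V W : lmodType K) (f g : V -> W) :
  linear f -> linear g -> submod (fun x => f x = g x).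
Proof.
move=> fL gL; split=> [|k x y Ex Ey]; first by rewrite !linear_map0.
by rewrite fL gL Ex Ey.
Qed.

Lemma scale_congr (V : lmodType K) (a b : K) (x : V) : a = b -> a *: x = b *: x.
Proof. by move=> ->. Qed.

Lemma tens_map_square (A B C E A' B' C' E' : lmodType K)
  (f : A -> B) (g : B -> E) (h : A -> C) (k : C -> E)
  (f' : A' -> B') (g' : B' -> E') (h' : A' -> C') (k' : C' -> E') :
  [/\ linear f, linear g, linear h & linear k] ->
  [/\ linear f', linear g', linear h' & linear k'] ->
  (forall x, g (f x) = k (h x)) -> (forall x, g' (f' x) = k' (h' x)) ->
  forall t, tens_map g g' (tens_map f f' t) = tens_map k k' (tens_map h h' t).
Proof.
move=> [fL gL hL kL] [fL' gL' hL' kL'] e e'; apply: tens_ext.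
- exact: (comp_linear (tens_map_linear gL gL') (tens_map_linear fL fL')).
- exact: (comp_linear (tens_map_linear kL kL') (tens_map_linear hL hL')).
by move=> a b; rewrite !tens_mapE // e e'.
Qed.

End LinearMaps.

(** * The tensor algebra on words *)

Section TensorWords.
Variables (K : fieldType) (H : finGroupType) (Phi : H -> H -> H -> K).
Variables (l : nat) (d : 'I_l -> H) (chi : 'I_l -> H -> K).
Local Notation T := (talg K l).
Local Notation tw := (@tword K l).

Lemma t_degE g w : t_deg d g (tw w) = if wdeg d w == g then tw w else 0.
Proof. exact: lin_extU. Qed.
Lemma t_actE e w : t_act Phi d chi e (tw w) = wchar Phi d chi e w *: tw w.
Proof. exact: lin_extU. Qed.
Lemma t_mulE u v : t_mul Phi d (tw u) (tw v) = wcoef Phi d u v *: tw (u ++ v).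
Proof. by rewrite /t_mul !lin_extU. Qed.
Lemma t_lenE r w :
  t_len (K:=K) (l:=l) r (tw w) = if size w == r then tw w else 0.
Proof. exact: lin_extU. Qed.
Lemma t_comulE w : t_comul Phi d chi (tw w) = w_comul Phi d chi w.
Proof. exact: lin_extU. Qed.
Lemma t_antiE w : t_anti Phi d chi (tw w) = w_anti Phi d chi w.
Proof. exact: lin_extU. Qed.
Lemma t_counitE w : t_counit (tw w) = (w == [::])%:R.
Proof. by rewrite /t_counit /tword mcoeffU. Qed.

Lemma t_degL g : linear (t_deg (K:=K) d g).
Proof. exact: lin_ext_is_linear. Qed.
Lemma t_actL e : linear (t_act Phi d chi e).
Proof. exact: lin_ext_is_linear. Qed.
Lemma t_lenL r : linear (t_len (K:=K) (l:=l) r).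
Proof. exact: lin_ext_is_linear. Qed.
Lemma t_comulL : linear (t_comul Phi d chi).
Proof. exact: lin_ext_is_linear. Qed.
Lemma t_antiL : linear (t_anti Phi d chi).
Proof. exact: lin_ext_is_linear. Qed.
Lemma t_mulLl y : linear ((t_mul Phi d)^~ y).
Proof. exact: (t_mul_bilinear Phi d).1. Qed.
Lemma t_mulLr x : linear (t_mul Phi d x).
Proof. exact: (t_mul_bilinear Phi d).2. Qed.

Lemma wdeg_cat u v : wdeg d (u ++ v) = (wdeg d u * wdeg d v)%g.
Proof. by rewrite /wdeg big_cat. Qed.
Lemma wdeg_cons i w : wdeg d (i :: w) = (d i * wdeg d w)%g.
Proof. by rewrite /wdeg big_cons. Qed.
Lemma wdeg_nil : wdeg d [::] = 1%g.
Proof. by rewrite /wdeg big_nil. Qed.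

Local Notation tmul := (tens_mul Phi (t_deg (K:=K) d) (t_act Phi d chi)
  (t_mul Phi d)).

Definition tens_mul_form (a b c e : T) : tens T T :=
    \sum_(g1 : H) \sum_(g2 : H) \sum_(g3 : H) \sum_(g4 : H)
      braid_coef Phi g1 g2 g3 g4 *:
        (t_mul Phi d (t_deg d g1 a) (t_act Phi d chi g2 (t_deg d g3 c))
          \ox t_mul Phi d (t_deg d g2 b) (t_deg d g4 e)).

Lemma tens_mul_form_linear a b c e :
  [/\ linear (fun a => tens_mul_form a b c e),
      linear (fun b => tens_mul_form a b c e),
      linear (fun c => tens_mul_form a b c e) &
      linear (tens_mul_form a b c)].
Proof.
have [tl tr] := tpure_bilinear T T.
by split; do 4![apply: sum_linear => ?]; apply: scale_linear => k x y;
  rewrite !(t_degL, t_actL, t_mulLl, t_mulLr, tl, tr).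
Qed.

Lemma tens_mul_form_bilin a b : bilinear_map (tens_mul_form a b).
Proof.
split=> [e|c]; first by have [_ _ + _] := tens_mul_form_linear a b 0 e.
by have [_ _ _ +] := tens_mul_form_linear a b c 0.
Qed.

Lemma tens_mul_lift_bilin t :
  bilinear_map (fun a b => tens_lift (tens_mul_form a b) t).
Proof.
apply: (@tens_lift_bilin2 _ _ _ _ _ _ tens_mul_form) => [b|a] c e.
  by have [] := tens_mul_form_linear 0 b c e.
by have [] := tens_mul_form_linear a 0 c e.
Qed.

Lemma tens_mulLl t : linear (tmul^~ t).
Proof. exact: (tens_lift_linear (tens_mul_lift_bilin _)). Qed.

Lemma tens_mul_pure a b t :
  tmul (a \ox b) t = tens_lift (tens_mul_form a b) t.
Proof. exact: (tens_liftE (tens_mul_lift_bilin t)). Qed.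

Lemma scale_add_swap (V : lmodType K) (k q : K) (a b a' b' : V) :
  k *: (q *: a + b) + (q *: a' + b') = q *: (k *: a + a') + (k *: b + b').
Proof. by rewrite !scalerDr !scalerA [q * k]mulrC addrACA. Qed.

Lemma tens_mulL s : linear (tmul s).
Proof.
move=> k t t'; apply: (tens_ext (f := fun s => tmul s _)
                                (g := fun s => _ *: tmul s t + tmul s t')).
- exact: tens_mulLl.
- move=> q x y; rewrite !tens_mulLl.
  exact: scale_add_swap.
move=> a b; rewrite !tens_mul_pure.
exact: (tens_lift_linear (tens_mul_form_bilin a b)).
Qed.

(** Words are homogeneous, so exactly one term of the fourfold sum over degrees survives. *)
Lemma tens_mulE u1 u2 u3 u4 :
  tmul (tw u1 \ox tw u2) (tw u3 \ox tw u4) =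
  (braid_coef Phi (wdeg d u1) (wdeg d u2) (wdeg d u3) (wdeg d u4) *
   wchar Phi d chi (wdeg d u2) u3 * wcoef Phi d u1 u3 * wcoef Phi d u2 u4) *:
  (tw (u1 ++ u3) \ox tw (u2 ++ u4)).
Proof.
rewrite tens_mul_pure (tens_liftE (tens_mul_form_bilin _ _)) /tens_mul_form.
rewrite (@big_only1 _ _ _ _ (wdeg d u1) xpredT _ isT) => [|g ne _]; last first.
  do 3![apply: big1 => ? _].
  by rewrite t_degE eq_sym (negPf ne) (linear_map0 (t_mulLl _)) tpure0l scaler0.
rewrite (@big_only1 _ _ _ _ (wdeg d u2) xpredT _ isT) => [|g ne _]; last first.
  do 2![apply: big1 => ? _].
  by rewrite (t_degE _ u2) eq_sym (negPf ne) (linear_map0 (t_mulLl _)) 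
    tpure0r scaler0.
rewrite (@big_only1 _ _ _ _ (wdeg d u3) xpredT _ isT) => [|g ne _]; last first.
  apply: big1 => ? _.
  by rewrite (t_degE _ u3) eq_sym (negPf ne) (linear_map0 (t_actL _))
    (linear_map0 (t_mulLr _)) tpure0l scaler0.
rewrite (@big_only1 _ _ _ _ (wdeg d u4) xpredT _ isT) => [|g ne _]; last first.
  by rewrite (t_degE _ u4) eq_sym (negPf ne) (linear_map0 (t_mulLr _)) 
    tpure0r scaler0.
rewrite !t_degE !eqxx t_actE (linear_mapZ (t_mulLr _)) !t_mulE.
by rewrite tpureZl tpureZl tpureZr 3!scalerA !mulrA.
Qed.

Lemma w_comul_cons i w :
  t_comul Phi d chi (tw (i :: w)) =
  tmul (tw [:: i] \ox tw [::]) (t_comul Phi d chi (tw w)) +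
  tmul (tw [::] \ox tw [:: i]) (t_comul Phi d chi (tw w)).
Proof. by rewrite !t_comulE /= (linear_mapD (tens_mulLl _)). Qed.

End TensorWords.

(** * Multidegrees *)

Section Multidegree.
Variables (l : nat).
Implicit Types (u w : seq 'I_l).

Lemma wmdeg_nil : wmdeg ([::] : seq 'I_l) = 0.
Proof. by rewrite /wmdeg big_nil. Qed.
Lemma wmdeg_cat u v : wmdeg (u ++ v) = wmdeg u + wmdeg v.
Proof. by rewrite /wmdeg big_cat. Qed.
Lemma wmdeg_cons i w : wmdeg (i :: w) = wmdeg [:: i] + wmdeg w.
Proof. exact: (wmdeg_cat [:: i]). Qed.

Lemma wmdeg_count w i : wmdeg w 0 i = (count_mem i w)%:R.
Proof.
elim: w => [|j w IH]; first by rewrite wmdeg_nil mxE.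
by rewrite /wmdeg big_cons mxE -/(wmdeg w) IH mxE eqxx natrD eq_sym.
Qed.

Lemma wmdeg_perm u v : wmdeg u = wmdeg v -> perm_eq u v.
Proof.
move=> uv; apply/allP => i _ /=; apply/eqP.
have := congr1 (fun M : 'rV[int]_l => M 0 i) uv.
by rewrite /= !wmdeg_count !ssrint.natz => -[].
Qed.

(** A multidegree counts letters and so determines a word up to permutation; commutativity does the
    rest. *)
Lemma wdeg_perm (H : finGroupType) (d : 'I_l -> H) u v :
  (forall x y : H, commute x y) -> wmdeg u = wmdeg v -> wdeg d u = wdeg d v.
Proof.
move=> comm /wmdeg_perm; apply: (catCA_perm_subst (F := wdeg d)).
by move=> s1 s2 s3; rewrite !wdeg_cat !mulgA [(wdeg d s1 * _)%g]comm.
Qed.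

(* The junk value [::] is taken when no word has multidegree v. *)
Definition wrep (v : 'rV[int]_l) : seq 'I_l :=
  if pselect (exists w, wmdeg w == v) is left P then xchoose P else [::].

Lemma wrepK w : wmdeg (wrep (wmdeg w)) = wmdeg w.
Proof.
rewrite /wrep; case: pselect => [P|[]]; last by exists w.
exact/eqP/(xchooseP P).
Qed.

Variable K : fieldType.
Definition t_mdeg (v : 'rV[int]_l) : talg K l -> talg K l :=
  lin_ext (fun w => if wmdeg w == v then tword K w else 0).

Lemma t_mdegE v w :
  t_mdeg v (tword K w) = if wmdeg w == v then tword K w else 0.
Proof. exact: lin_extU. Qed.
Lemma t_mdegL v : linear (t_mdeg v). Proof. exact: lin_ext_is_linear. Qed.

Lemma t_mdeg_coef v x w : (t_mdeg v x)@_w = if wmdeg w == v then x@_w else 0.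
Proof.
move: x; apply: malg_ind => [|u].
  split=> [|k x y]; first by rewrite (linear_map0 (t_mdegL v)) !mcoeff0 if_same.
  rewrite t_mdegL !mcoeffD !mcoeffZ => -> ->.
  by case: ifP; rewrite // mulr0 addr0.
rewrite -/(tword K u) t_mdegE /tword; case: (eqVneq u w) => [->|ne].
  by case: ifP; rewrite ?mcoeff0.
by rewrite mcoeffU (negPf ne) if_same; case: ifP;
  rewrite ?mcoeff0 // mcoeffU (negPf ne).
Qed.

Lemma t_mdeg_sum x : exists s, x = \sum_(v <- s) t_mdeg v x.
Proof.
(* There are infinitely many multidegrees, so the sum is restricted to those of the support; [undup]
   prevents counting a component twice. *)
exists (undup [seq wmdeg w | w <- msupp x]); apply/malgP => w.
rewrite raddf_sum /=; under eq_bigr => v _ do rewrite t_mdeg_coef.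
have [wx|wx] := boolP (w \in msupp x); last first.
  by rewrite mcoeff_outdom // big1 // => v _; rewrite if_same.
rewrite (bigD1_seq (wmdeg w)) ?undup_uniq ?mem_undup ?map_f //= eqxx.
by rewrite big1 ?addr0 // => v; rewrite eq_sym => /negPf ->.
Qed.

End Multidegree.

(** * Twisted data *)

(** The group is a field of the record, so that data over different groups have a common type. *)
Record yd_data (K : fieldType) (l : nat) := YdData {
  dgrp : finGroupType;
  dPhi : dgrp -> dgrp -> dgrp -> K;
  ddeg : 'I_l -> dgrp;
  dchi : 'I_l -> dgrp -> K }.

Arguments dPhi {K l} D : rename.
Arguments ddeg {K l} D : rename.
Arguments dchi {K l} D : rename.

Notation dmul D := (t_mul (dPhi D) (ddeg D)).
Notation dact D := (t_act (dPhi D) (ddeg D) (dchi D)).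
Notation dproj D := (t_deg (ddeg D)).
Notation dcomul D := (t_comul (dPhi D) (ddeg D) (dchi D)).
Notation danti D := (t_anti (dPhi D) (ddeg D) (dchi D)).
Notation dwdeg D := (wdeg (ddeg D)).
Notation dcoef D := (wcoef (dPhi D) (ddeg D)).
Notation dchar D := (wchar (dPhi D) (ddeg D) (dchi D)).

(* The map tword w |-> c w *: tword w carries the operations of D to those of
   D' up to the scalars q, which depend on multidegrees only. The two groups
   are unrelated: tw_act merely asks that, in each multidegree, the action of
   an element of one group be proportional to that of some element of the
   other, which is all that the transport of ideals needs. The factors
   q' u2 u3 and q' u3 u2 of tw_braid cancel those that tw_char produces when
   the second tensor factor acts on the third. *)
Record twisted (K : fieldType) (l : nat) (D D' : yd_data K l)
   (q : 'rV[int]_l -> 'rV[int]_l -> K) (c : seq 'I_l -> K) : Prop := Twisted {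
  tw_c0 : forall w, c w != 0;
  tw_q0 : forall u v, q u v != 0;
  tw_q0l : forall v, q 0 v = 1;
  tw_q0r : forall v, q v 0 = 1;
  tw_cnil : c [::] = 1;
  tw_ccons : forall i w, c (i :: w) = q (wmdeg [:: i]) (wmdeg w) * c w;
  tw_mul : forall u v,
    dcoef D u v * c (u ++ v) =
    q (wmdeg u) (wmdeg v) * c u * c v * dcoef D' u v;
  tw_char : forall u w,
    dchar D (dwdeg D u) w * q (wmdeg w) (wmdeg u) =
    q (wmdeg u) (wmdeg w) * dchar D' (dwdeg D' u) w;
  tw_braid : forall u1 u2 u3 u4,
    let q' u v := q (wmdeg u) (wmdeg v) in
    let w := dwdeg D in let w' := dwdeg D' in
    braid_coef (dPhi D) (w u1) (w u2) (w u3) (w u4) *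
      (q' (u1 ++ u3) (u2 ++ u4) * q' u1 u3 * q' u2 u4 * q' u2 u3) =
    q' (u1 ++ u2) (u3 ++ u4) * q' u1 u2 * q' u3 u4 * q' u3 u2 *
    braid_coef (dPhi D') (w' u1) (w' u2) (w' u3) (w' u4);
  tw_act : forall e, exists e' k, forall w,
    dchar D' e w = k (wmdeg w) * dchar D e' w;
  tw_act_inv : forall e, exists e' k, forall w,
    dchar D e w = k (wmdeg w) * dchar D' e' w;
  tw_deg : forall u v, wmdeg u = wmdeg v -> dwdeg D u = dwdeg D v;
  tw_deg_inv : forall u v, wmdeg u = wmdeg v -> dwdeg D' u = dwdeg D' v }.

(** All scalars are invertible, so each identity can be solved for the other side. Ideals are
    therefore transported in one direction only, and the inverse map comes for free. *)
Lemma twisted_sym (K : fieldType) (l : nat) (D D' : yd_data K l) q c :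
  twisted D D' q c -> twisted D' D (fun u v => (q u v)^-1) (fun w => (c w)^-1).
Proof.
case=> c0 q0 q0l q0r cn cc tm tc tb ta tai td tdi; split=> //.
- by move=> w; rewrite invr_eq0.
- by move=> u v; rewrite invr_eq0.
- by move=> v; rewrite q0l invr1.
- by move=> v; rewrite q0r invr1.
- by rewrite cn invr1.
- by move=> i w; rewrite cc invfM.
- move=> u v; have := tm u v;
    move: (c0 u) (c0 v) (c0 (u ++ v)) (q0 (wmdeg u) (wmdeg v)).
  move: (wcoef _ _ _ _) (wcoef _ _ _ _) (c u) (c v) (c (u ++ v)) (q _ _) =>
    k1 k2 a b e f a0 b0 e0 f0 E.
  have -> : k2 = k2 * e / e by field.
  by rewrite E; field; rewrite a0 b0 e0 f0.
- move=> u w; have := tc u w;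
    move: (q0 (wmdeg u) (wmdeg w)) (q0 (wmdeg w) (wmdeg u)).
  move: (wchar _ _ _ _ _) (wchar _ _ _ _ _) (q _ _) (q _ _) =>
    k1 k2 a b a0 b0 E.
  have -> : k2 = k2 * a / a by field.
  by rewrite E; field; rewrite a0 b0.
- move=> u1 u2 u3 u4 /=; have := tb u1 u2 u3 u4 => /=.
  set a1 := q _ _; set a2 := q _ _; set a3 := q _ _; set a4 := q _ _.
  set a5 := q _ _; set a6 := q _ _; set a7 := q _ _; set a8 := q _ _.
  have [z1 z2 z3 z4] : [/\ a1 != 0, a2 != 0, a3 != 0 & a4 != 0]
    by split; exact: q0.
  have [z5 z6 z7 z8] : [/\ a5 != 0, a6 != 0, a7 != 0 & a8 != 0]
    by split; exact: q0.
  move: (braid_coef _ _ _ _ _) (braid_coef _ _ _ _ _) => b1 b2 E.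
  have -> : b2 = b2 * (a1 * a2 * a3 * a4) / (a1 * a2 * a3 * a4).
    by field; rewrite z1 z2 z3 z4.
  by rewrite E; field; rewrite z1 z2 z3 z4 z5 z6 z7 z8.
Qed.

(** * The coproduct preserves multidegrees *)

Section Homogeneity.
Variables (K : fieldType) (l : nat) (D : yd_data K l).
Local Notation T := (talg K l).
Local Notation tw := (@tword K l).
Local Notation Phi := (dPhi D).
Local Notation d := (ddeg D).
Local Notation chi := (dchi D).

Definition tdata : ydHopf K (dgrp D) l := tensor_hopf Phi d chi.

Definition homog2 (v : 'rV[int]_l) (t : tens T T) : Prop :=
  exists u u', wmdeg u + wmdeg u' = v /\ t = tw u \ox tw u'.

Lemma w_comul_homog w : lspan (homog2 (wmdeg w)) (t_comul Phi d chi (tw w)).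
Proof.
elim: w => [|i w IH].
  apply: lspan_incl; exists [::], [::].
  by rewrite t_comulE wmdeg_nil addr0.
have sL := lspan_submod (homog2 (wmdeg (i :: w))).
rewrite w_comul_cons; apply: (submodD sL);
  move: (t_comul _ _ _ _) IH;
    (apply: lspan_stable; [exact: tens_mulL|exact: sL|]);
  move=> _ [u [u' [uu' ->]]]; rewrite tens_mulE; apply: (submodZ sL);
  apply: lspan_incl.
  exists ([:: i] ++ u), ([::] ++ u'); split=> //.
  by rewrite cat0s wmdeg_cat (wmdeg_cons i w) -uu' addrA.
exists ([::] ++ u), ([:: i] ++ u'); split=> //.
by rewrite cat0s wmdeg_cat (wmdeg_cons i w) -uu' addrCA.
Qed.

End Homogeneity.

(** * The rescaling of words against the structure maps *)

Section Transfer.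
Variables (K : fieldType) (l : nat) (D D' : yd_data K l).
Variables (q : 'rV[int]_l -> 'rV[int]_l -> K) (c : seq 'I_l -> K).
Hypothesis tD : twisted D D' q c.
Local Notation T := (talg K l).
Local Notation tw := (@tword K l).
Local Notation qw u v := (q (wmdeg u) (wmdeg v)).
Implicit Types (v : 'rV[int]_l) (x y : T) (u w : seq 'I_l).

Let c0 := tw_c0 tD.
Let q0 := tw_q0 tD.

Definition t_scale : T -> T := lin_ext (fun w => c w *: tw w).
Local Notation F := t_scale.

Lemma t_scaleE w : F (tw w) = c w *: tw w. Proof. exact: lin_extU. Qed.
Lemma t_scaleL : linear F. Proof. exact: lin_ext_is_linear. Qed.

Lemma scale_mdeg_linear v : linear (fun x => F (t_mdeg v x)).
Proof. by move=> k x y; rewrite t_mdegL t_scaleL. Qed.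

Lemma scale_mdegE v w :
  F (t_mdeg v (tw w)) = if wmdeg w == v then c w *: tw w else 0.
Proof.
by rewrite t_mdegE; case: ifP => _; rewrite ?t_scaleE // (linear_map0 t_scaleL).
Qed.

(** On a single multidegree the factor [q] of [tw_mul] is a constant and can be pulled out; this is
    why [F] is composed with [t_mdeg]. Multiplying by words is enough for ideals, by linearity. *)
Lemma scale_mdeg_mulr v x w :
  dmul D' (F (t_mdeg v x)) (tw w) =
  (q v (wmdeg w) * c w)^-1 *:
    F (t_mdeg (v + wmdeg w) (dmul D x (tw w))).
Proof.
move: x; apply: malg_ext => [k x y|k x y|u]; rewrite -?/(tw u).
- by rewrite scale_mdeg_linear t_mulLl.
- by rewrite t_mulLl scale_mdeg_linear scalerDr !scalerA mulrC.
rewrite t_mulE (linear_mapZ (scale_mdeg_linear _)) !scale_mdegE wmdeg_cat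
  (inj_eq (addIr _)).
case: eqP => [<-|_]; last by rewrite (linear_map0 (t_mulLl _ _ _)) !scaler0.
rewrite (linear_mapZ (t_mulLl _ _ _)) t_mulE 3!scalerA; congr (_ *: _).
rewrite -mulrA (tw_mul tD); move: (c0 w) (q0 (wmdeg u) (wmdeg w)) => ? ?.
by field; apply/andP.
Qed.

Lemma scale_mdeg_mull v x w :
  dmul D' (tw w) (F (t_mdeg v x)) =
  (q (wmdeg w) v * c w)^-1 *:
    F (t_mdeg (wmdeg w + v) (dmul D (tw w) x)).
Proof.
move: x; apply: malg_ext => [k x y|k x y|u]; rewrite -?/(tw u).
- by rewrite scale_mdeg_linear t_mulLr.
- by rewrite t_mulLr scale_mdeg_linear scalerDr !scalerA mulrC.
rewrite t_mulE (linear_mapZ (scale_mdeg_linear _)) !scale_mdegE wmdeg_cat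
  (inj_eq (addrI _)).
case: eqP => [<-|_]; last by rewrite (linear_map0 (t_mulLr _ _ _)) !scaler0.
rewrite (linear_mapZ (t_mulLr _ _ _)) t_mulE 3!scalerA; congr (_ *: _).
rewrite -mulrA (tw_mul tD); move: (c0 w) (q0 (wmdeg w) (wmdeg u)) => ? ?.
by field; apply/andP.
Qed.

Lemma scale_mdeg_deg g v x :
  dproj D' g (F (t_mdeg v x)) =
  (dwdeg D' (wrep v) == g)%:R *: F (t_mdeg v x).
Proof.
move: x; apply: malg_ext => [k x y|k x y|u]; rewrite -?/(tw u).
- by rewrite scale_mdeg_linear t_degL.
- by rewrite scale_mdeg_linear scalerDr !scalerA mulrC.
rewrite scale_mdegE; case: eqP => [<-|_];
  last by rewrite (linear_map0 (t_degL _ _)) scaler0.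
rewrite (linear_mapZ (t_degL _ _)) t_degE (tw_deg_inv tD (wrepK u)).
by case: ifP; rewrite ?scale1r ?scale0r ?scaler0.
Qed.

Lemma scale_mdeg_act e v : exists e' k, forall x,
  dact D' e (F (t_mdeg v x)) = k *: F (t_mdeg v (dact D e' x)).
Proof.
have [e' [k Ek]] := tw_act tD e; exists e', (k v).
apply: malg_ext => [a x y|a x y|u]; rewrite -?/(tw u).
- by rewrite scale_mdeg_linear t_actL.
- by rewrite t_actL scale_mdeg_linear scalerDr !scalerA mulrC.
rewrite t_actE (linear_mapZ (scale_mdeg_linear _)) scale_mdegE.
case: eqP => [<-|_]; last by rewrite (linear_map0 (t_actL _ _ _ _)) !scaler0.
rewrite (linear_mapZ (t_actL _ _ _ _)) t_actE 3!scalerA Ek; congr (_ *: _).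
by rewrite mulrC.
Qed.

Lemma scale_mdeg_len r v x :
  t_len r (F (t_mdeg v x)) = F (t_mdeg v (t_len r x)).
Proof.
move: x; apply: malg_ext => [k x y|k x y|u]; rewrite -?/(tw u).
- by rewrite scale_mdeg_linear t_lenL.
- by rewrite t_lenL scale_mdeg_linear.
rewrite t_lenE; case: ifP => sz; rewrite !scale_mdegE; case: ifP => uv;
  rewrite ?(linear_map0 (scale_mdeg_linear v)) ?(linear_map0 (t_lenL _)) //;
  by rewrite (linear_mapZ (t_lenL _)) t_lenE sz ?scaler0.
Qed.

Lemma scale_mdeg_counit v x :
  t_counit (F (t_mdeg v x)) = (v == 0)%:R * t_counit x.
Proof.
have cL : linear (@t_counit K l : T -> K^o).
  by move=> k a b; rewrite /t_counit mcoeffD mcoeffZ.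
move: x; apply: (@malg_ext _ _ K^o) => [k x y|k x y|u]; rewrite -?/(tw u).
- by rewrite scale_mdeg_linear cL.
- by rewrite /t_counit mcoeffD mcoeffZ mulrDr mulrCA.
rewrite scale_mdegE t_counitE; case: eqP => [<-|vu].
  rewrite (linear_mapZ cL) t_counitE; case: eqP => [->|_];
    last by rewrite scaler0 mulr0.
  by rewrite (tw_cnil tD) wmdeg_nil eqxx scale1r mulr1.
rewrite (linear_map0 cL); case: (u =P [::]) => [u0|_]; rewrite ?mulr0 // mulr1.
by move: vu; rewrite u0 wmdeg_nil => vu; case: eqP => // v0; case: vu.
Qed.

Lemma wmdeg_rev w : wmdeg (rev w) = wmdeg w.
Proof.
elim: w => [|i w IH] //; rewrite rev_cons -cats1 wmdeg_cat IH.
by rewrite (wmdeg_cons i w) addrC.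
Qed.

(** The antipode reverses words up to a scalar. Reversal moves $X_i$ from the left end to the right
    end, which turns $q(X_i,w)$ into $q(w,X_i)$; the action of $\deg X_i$ contributes the opposite
    exchange by [tw_char], so no factor [q] is left over. *)
Lemma w_anti_transfer w : exists k k',
  [/\ danti D (tw w) = k *: tw (rev w),
      danti D' (tw w) = k' *: tw (rev w) &
      c w * k' = k * c (rev w)].
Proof.
elim: w => [|i w [k [k' [E E' kk']]]].
  by exists 1, 1; rewrite !t_antiE /= !scale1r mulr1 mul1r.
have anti_cons (A : yd_data K l) a :
    danti A (tw w) = a *: tw (rev w) ->
    danti A (tw (i :: w)) =
    - (a * dchar A (dwdeg A [:: i]) (rev w) *
       dcoef A (rev w) [:: i]) *: tw (rev (i :: w)).
  rewrite !t_antiE /= => ->; rewrite (linear_mapZ (t_actL _ _ _ _)).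
  rewrite t_actE scalerA (linear_mapZ (t_mulLl _ _ _)) t_mulE scalerA scaleNr.
  by rewrite rev_cons -cats1 wdeg_cons wdeg_nil mulg1.
do 2 eexists; split; [exact: anti_cons E | exact: anti_cons E' |].
have := tw_mul tD (rev w) [:: i]; have := tw_char tD [:: i] (rev w).
rewrite rev_cons -cats1 (tw_ccons tD i w) (tw_ccons tD i [::]) (tw_cnil tD).
rewrite wmdeg_rev wmdeg_nil (tw_q0r tD) !mulr1.
move: (wchar _ _ _ _ _) (wchar _ _ _ _ _) (wcoef _ _ _ _) (wcoef _ _ _ _).
move=> h' h m' m Eh Em.
rewrite !mulNr mulrN; congr (- _).
rewrite -!mulrA Em.
transitivity (q (wmdeg [:: i]) (wmdeg w) * (c w * k') * h' * m'); first by ring.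
rewrite kk'.
transitivity ((h * q (wmdeg w) (wmdeg [:: i])) * (k * c (rev w)) * m').
  by rewrite Eh; ring.
by ring.
Qed.

Lemma scale_mdeg_anti v x :
  danti D' (F (t_mdeg v x)) = F (t_mdeg v (danti D x)).
Proof.
move: x; apply: malg_ext => [k x y|k x y|w]; rewrite -?/(tw w).
- by rewrite scale_mdeg_linear t_antiL.
- by rewrite t_antiL scale_mdeg_linear.
have [k [k' [-> E' kk']]] := w_anti_transfer w.
rewrite (linear_mapZ (scale_mdeg_linear _)) !scale_mdegE wmdeg_rev.
case: ifP => _; last by rewrite (linear_map0 (t_antiL _ _ _)) scaler0.
by rewrite (linear_mapZ (t_antiL _ _ _)) E' 2!scalerA kk'.
Qed.

(* The component of multidegree v of the map T \ox T -> T \ox T that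
   intertwines the two coproducts. *)
Definition tens_scale_form v x y : tens T T :=
  lin_ext (fun u => lin_ext (fun w =>
    if wmdeg u + wmdeg w == v then (qw u w * c u * c w) *: (tw u \ox tw w)
    else 0) y) x.

Lemma tens_scale_form_bilin v : bilinear_map (tens_scale_form v).
Proof.
split=> [y|x]; first exact: lin_ext_is_linear.
apply: (@lin_ext_fun_linear _ _ _ _ (fun y u => lin_ext _ y)) => u.
exact: lin_ext_is_linear.
Qed.

Definition tens_scale v : tens T T -> tens T T := tens_lift (tens_scale_form v).

Lemma tens_scaleL v : linear (tens_scale v).
Proof. exact: (tens_lift_linear (tens_scale_form_bilin v)). Qed.

Lemma tens_scale_pure v x y : tens_scale v (x \ox y) = tens_scale_form v x y.
Proof. exact: (tens_liftE (tens_scale_form_bilin v)). Qed.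

Lemma tens_scaleE v u w : tens_scale v (tw u \ox tw w) =
  if wmdeg u + wmdeg w == v then (qw u w * c u * c w) *: (tw u \ox tw w) else 0.
Proof. by rewrite tens_scale_pure /tens_scale_form !lin_extU. Qed.

Lemma tens_scale_homog0 v v' t :
  v != v' -> lspan (homog2 v') t -> tens_scale v t = 0.
Proof.
move=> ne; have sP : submod (fun t => tens_scale v t = 0).
  split=> [|k a b Ea Eb]; first exact: linear_map0 (tens_scaleL v).
  by rewrite tens_scaleL Ea Eb scaler0 addr0.
move=> /(_ _ sP); apply=> _ [u [w [uw ->]]].
by rewrite tens_scaleE uw eq_sym (negPf ne).
Qed.

Local Notation tmul := (tens_mul (dPhi D) (dproj D) (dact D) (dmul D)).
Local Notation tmul' := (tens_mul (dPhi D') (dproj D') (dact D') (dmul D')).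

(** Since the intertwiner multiplies [tw a \ox tw b] by [qw a b * c a * c b], this is the law of
    [tw_mul] one level up: the intertwiner of $T\otimes T$ is multiplicative up to [q] of the total
    multidegrees. A pair of words on the left is all that the recursion for the coproduct uses. *)
Lemma tens_scale_mul a b v t : lspan (homog2 v) t ->
  tens_scale (wmdeg a + wmdeg b + v) (tmul (tw a \ox tw b) t) =
  (q (wmdeg a + wmdeg b) v * qw a b * c a * c b) *:
    tmul' (tw a \ox tw b) (tens_scale v t).
Proof.
have sW : submod (fun t =>
  tens_scale (wmdeg a + wmdeg b + v) (tmul (tw a \ox tw b) t) =
  (q (wmdeg a + wmdeg b) v * qw a b * c a * c b) *:
    tmul' (tw a \ox tw b) (tens_scale v t)).
  apply: submod_eq.
    exact: (comp_linear (tens_scaleL _) (tens_mulL _ _ _ _)).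
  apply: scale_linear; exact: (comp_linear (tens_mulL _ _ _ _) (tens_scaleL v)).
move=> /(_ _ sW); apply=> _ [u [w [<- ->]]];
  rewrite tens_mulE !tens_scaleE eqxx.
rewrite (linear_mapZ (tens_scaleL _)) tens_scaleE !wmdeg_cat addrACA eqxx.
rewrite (linear_mapZ (tens_mulL (dPhi D') (ddeg D') (dchi D') _)) tens_mulE.
rewrite 3!scalerA; apply: scale_congr.
have := tw_braid tD a b u w => /=; rewrite !wmdeg_cat.
move: (tw_mul tD a u) (tw_mul tD b w) (tw_char tD b u) (q0 (wmdeg u) (wmdeg b)).
set r := braid_coef (dPhi D) _ _ _ _; set r' := braid_coef (dPhi D') _ _ _ _.
set m1 := wcoef (dPhi D) _ a u; set m1' := wcoef (dPhi D') _ a u.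
set m2 := wcoef (dPhi D) _ b w; set m2' := wcoef (dPhi D') _ b w.
set h := wchar (dPhi D) _ _ _ _; set h' := wchar (dPhi D') _ _ _ _.
(* The factor [q] of (u, b) does not occur in the goal; multiplying by it produces the left-hand
   side of [tw_char], and [tw_braid] returns it at the end. *)
set qub := qw u b; move=> E1 E2 Eh qub0 Er; apply: (mulIf qub0).
transitivity (r * (q (wmdeg a + wmdeg u) (wmdeg b + wmdeg w)) *
  (h * qub) * (m1 * c (a ++ u)) * (m2 * c (b ++ w))); first by ring.
rewrite Eh E1 E2.
transitivity (
  (r * (q (wmdeg a + wmdeg u) (wmdeg b + wmdeg w) * qw a u * qw b w * qw b u)) *
   h' * m1' * m2' * c a * c b * c u * c w); first by ring.
by rewrite Er; ring.
Qed.

Lemma tens_scale_comul w :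
  tens_scale (wmdeg w) (dcomul D (tw w)) = c w *: dcomul D' (tw w).
Proof.
elim: w => [|i w IH].
  rewrite !t_comulE /= tens_scaleE !wmdeg_nil addr0 eqxx.
  by rewrite (tw_q0l tD) (tw_cnil tD) !mulr1.
have hw := @w_comul_homog _ _ D w.
have ci : c [:: i] = 1.
  by rewrite (tw_ccons tD i [::]) wmdeg_nil (tw_q0r tD) (tw_cnil tD) mulr1.
(* This covers both $X_i\otimes 1$ and $1\otimes X_i$, which the intertwiner fixes because [q] is
   normalized and [c [:: i]] is 1. *)
have step a b : wmdeg a + wmdeg b = wmdeg [:: i] -> qw a b * c a * c b = 1 ->
    tens_scale (wmdeg (i :: w)) (tmul (tw a \ox tw b) (dcomul D (tw w))) =
    c (i :: w) *: tmul' (tw a \ox tw b) (dcomul D' (tw w)).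
  move=> ab ab1; rewrite (wmdeg_cons i w) -ab (tens_scale_mul a b hw) IH ab.
  have -> : q (wmdeg [:: i]) (wmdeg w) * qw a b * c a * c b =
      q (wmdeg [:: i]) (wmdeg w) by rewrite -[RHS]mulr1 -ab1 !mulrA.
  rewrite (tw_ccons tD).
  rewrite (linear_mapZ (tens_mulL (dPhi D') (ddeg D') (dchi D') _)).
  exact: scalerA.
have s1 : wmdeg [:: i] + wmdeg ([::] : seq 'I_l) = wmdeg [:: i].
  by rewrite wmdeg_nil addr0.
have s2 : qw [:: i] [::] * c [:: i] * c [::] = 1.
  by rewrite wmdeg_nil (tw_q0r tD) (tw_cnil tD) ci !mulr1.
have s3 : wmdeg ([::] : seq 'I_l) + wmdeg [:: i] = wmdeg [:: i].
  by rewrite wmdeg_nil add0r.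
have s4 : qw [::] [:: i] * c [::] * c [:: i] = 1.
  by rewrite wmdeg_nil (tw_q0l tD) (tw_cnil tD) ci !mulr1.
rewrite (w_comul_cons (dPhi D)) (w_comul_cons (dPhi D')).
rewrite (linear_mapD (tens_scaleL (wmdeg (i :: w)))).
apply: etrans (congr2 +%R (step _ _ s1 s2) (step _ _ s3 s4)) _.
exact: esym (scalerDr _ _ _).
Qed.

Lemma scale_mdeg_comul v x :
  dcomul D' (F (t_mdeg v x)) = tens_scale v (dcomul D x).
Proof.
move: x; apply: malg_ext => [k x y|k x y|w]; rewrite -?/(tw w).
- by rewrite scale_mdeg_linear t_comulL.
- by rewrite t_comulL tens_scaleL.
rewrite scale_mdegE; case: eqP => [<-|/eqP ne].
  by rewrite (linear_mapZ (t_comulL _ _ _)) tens_scale_comul.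
by rewrite (linear_map0 (t_comulL _ _ _)) (tens_scale_homog0 (v' := wmdeg w))
  1?eq_sym //; apply: w_comul_homog.
Qed.

End Transfer.

(** * Transport of admissible ideals *)

Section Ideals.
Variables (K : fieldType) (l : nat) (D D' : yd_data K l).
Variables (q : 'rV[int]_l -> 'rV[int]_l -> K) (c : seq 'I_l -> K).
Hypothesis tD : twisted D D' q c.
Local Notation T := (talg K l).
Local Notation tw := (@tword K l).
Implicit Types (v : 'rV[int]_l) (x y : T) (u w : seq 'I_l) (J : T -> Prop).
Local Notation F := (t_scale c).
Let scale_mdegL := scale_mdeg_linear c.

(** Against a word, the total multidegree [v] selects a single component of [x]. Hence a tensor with
    [x] in an ideal is sent to one with its first factor in the hull of that ideal. *)
Lemma tens_scale_wordr v x w : tens_scale q c v (x \ox tw w) =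
  (q (v - wmdeg w) (wmdeg w) * c w) *: (F (t_mdeg (v - wmdeg w) x) \ox tw w).
Proof.
move: x; apply: malg_ext => [|| u].
- exact: (comp_linear (tens_scaleL q c v) ((tpure_bilinear T T).1 (tw w))).
- apply: scale_linear.
  exact: (comp_linear ((tpure_bilinear T T).1 (tw w)) (scale_mdegL _)).
rewrite -/(tw u) tens_scaleE scale_mdegE -(inj_eq (addIr (wmdeg w)) (wmdeg u))
  subrK.
case: eqP => [<-|_]; last by rewrite tpure0l scaler0.
rewrite addrK tpureZl scalerA; apply: scale_congr; exact: mulrAC.
Qed.

Lemma tens_scale_wordl v x w : tens_scale q c v (tw w \ox x) =
  (q (wmdeg w) (v - wmdeg w) * c w) *: (tw w \ox F (t_mdeg (v - wmdeg w) x)).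
Proof.
move: x; apply: malg_ext => [|| u].
- exact: (comp_linear (tens_scaleL q c v) ((tpure_bilinear T T).2 (tw w))).
- apply: scale_linear.
  exact: (comp_linear ((tpure_bilinear T T).2 (tw w)) (scale_mdegL _)).
rewrite -/(tw u) tens_scaleE scale_mdegE -(inj_eq (addIr (wmdeg w)) (wmdeg u))
  subrK addrC.
case: eqP => [<-|_]; last by rewrite tpure0r scaler0.
by rewrite addrK tpureZr scalerA.
Qed.

(* J is graded by dgrp D only; its multidegree components generate an ideal
   graded by any group, since degrees are functions of multidegrees. *)
Definition ideal_hull J : T -> Prop :=
  lspan (fun z => exists v y, J y /\ z = F (t_mdeg v y)).

Lemma ideal_hull_incl J v y : J y -> ideal_hull J (F (t_mdeg v y)).
Proof. by move=> Jy; apply: lspan_incl; exists v, y. Qed.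

Lemma ideal_hull_stable J (f : T -> T) : linear f ->
  (forall v y, J y -> ideal_hull J (f (F (t_mdeg v y)))) ->
  forall z, ideal_hull J z -> ideal_hull J (f z).
Proof.
move=> fL fJ; apply: lspan_stable => //; first exact: lspan_submod.
by move=> _ [v [y [Jy ->]]]; exact: fJ.
Qed.

Lemma t_scale_hull J x : J x -> ideal_hull J (F x).
Proof.
move=> Jx; have [s {1}->] := t_mdeg_sum x.
have sJ := lspan_submod (fun z => exists v y, J y /\ z = F (t_mdeg v y)).
elim: s => [|v s IH]; rewrite ?(big_nil, big_cons).
  by rewrite (linear_map0 (t_scaleL c)); case: sJ.
by rewrite (linear_mapD (t_scaleL c)); apply: (submodD sJ) => //;
  apply: ideal_hull_incl.
Qed.

Lemma ideal_hull_two_sided J : two_sided_ideal (A := tdata D) J ->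
  two_sided_ideal (A := tdata D') (ideal_hull J).
Proof.
move=> [[J0 JD] JM].
have sJ := lspan_submod (fun z => exists v y, J y /\ z = F (t_mdeg v y)).
split=> [|x y Jx]; first exact: sJ.
split; move: y; apply: malg_ind.
- exact: (submod_preim (t_mulLr (dPhi D') (ddeg D') x)).
- move=> w; move: x Jx; apply: ideal_hull_stable => [|v y Jy];
    first exact: t_mulLl.
  rewrite /= -/(tw w) (scale_mdeg_mulr tD); apply: (submodZ sJ);
    apply: ideal_hull_incl.
  by have [] := JM y (tw w) Jy.
- exact: (submod_preim (t_mulLl (dPhi D') (ddeg D') x)).
- move=> w; move: x Jx; apply: ideal_hull_stable => [|v y Jy];
    first exact: t_mulLr.
  rewrite /= -/(tw w) (scale_mdeg_mull tD); apply: (submodZ sJ);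
    apply: ideal_hull_incl.
  by have [] := JM y (tw w) Jy.
Qed.

Lemma ideal_hull_hopf J : hopf_ideal (A := tdata D) J ->
  hopf_ideal (A := tdata D') (ideal_hull J).
Proof.
move=> [iJ gJ aJ eJ cJ SJ].
have sJ := lspan_submod (fun z => exists v y, J y /\ z = F (t_mdeg v y)).
split; first exact: ideal_hull_two_sided.
- move=> g; apply: ideal_hull_stable => [|v y Jy]; first exact: t_degL.
  rewrite /= (scale_mdeg_deg tD); apply: (submodZ sJ); exact: ideal_hull_incl.
- move=> e; apply: ideal_hull_stable => [|v y Jy]; first exact: t_actL.
  have [e' [k Ek]] := scale_mdeg_act tD e v; rewrite /= Ek; apply: (submodZ sJ).
  by apply: ideal_hull_incl; exact: aJ.
- have cL : linear (@t_counit K l : T -> K^o).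
    by move=> k a b; rewrite /t_counit mcoeffD mcoeffZ.
  have sC : submod (fun x : T => t_counit x = 0).
    split=> [|k a b Ea Eb]; first exact: mcoeff0.
    by rewrite cL Ea Eb scaler0 addr0.
  move=> x /(_ _ sC); apply=> _ [v [y [Jy ->]]].
  by rewrite (scale_mdeg_counit tD) [t_counit y](eJ y Jy) mulr0.
- apply: lspan_stable; [exact: t_comulL | exact: lspan_submod |].
  move=> _ [v [y [Jy ->]]]; rewrite /= (scale_mdeg_comul tD).
  have := cJ y Jy; apply: lspan_stable;
    [exact: tens_scaleL | exact: lspan_submod |].
  (* The factor outside the ideal is reduced to a word by linearity; the other factor then
     contributes one rescaled component. *)
  move=> _ [a [b [[Ja|Jb] ->]]].
    move: b; apply: malg_ind => [|w].
      apply: submod_preim; last exact: lspan_submod.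
      exact: (comp_linear (tens_scaleL q c v) ((tpure_bilinear T T).2 a)).
    rewrite -/(tw w) tens_scale_wordr; apply: (submodZ (lspan_submod _)).
    apply: lspan_incl; do 2 eexists; split; last by reflexivity.
    by left; apply: ideal_hull_incl.
  move: a; apply: malg_ind => [|w].
    apply: submod_preim; last exact: lspan_submod.
    exact: (comp_linear (tens_scaleL q c v) ((tpure_bilinear T T).1 b)).
  rewrite -/(tw w) tens_scale_wordl; apply: (submodZ (lspan_submod _)).
  apply: lspan_incl; do 2 eexists; split; last by reflexivity.
  by right; apply: ideal_hull_incl.
- apply: ideal_hull_stable => [|v y Jy]; first exact: t_antiL.
  by rewrite /= (scale_mdeg_anti tD); apply: ideal_hull_incl; exact: SJ.
Qed.

Lemma ideal_hull_admissible J :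
  admissible_ideal (Phi := dPhi D) (d := ddeg D) (chi := dchi D) J ->
  admissible_ideal (Phi := dPhi D') (d := ddeg D') (chi := dchi D')
    (ideal_hull J).
Proof.
move=> [hJ lJ [S [S2 JS]]].
have hJ' := ideal_hull_hopf hJ.
split; first exact: hJ'.
  move=> r; apply: ideal_hull_stable => [|v y Jy]; first exact: t_lenL.
  by rewrite scale_mdeg_len; apply: ideal_hull_incl; exact: lJ.
(* The largest possible generating set is taken: every length-homogeneous element of the hull of
   length at least 2. *)
pose S' z := ideal_hull J z /\ exists2 r, (2 <= r)%N & t_len r z = z.
exists S'; split=> [y []//|x]; split=> [Jx|]; last first.
  by apply; [case: hJ' | move=> y []].
have sG := @gen_ideal_submod K (dgrp D') (dPhi D') l (ddeg D') (dchi D') S'.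
apply: Jx => // _ [v [y [Jy ->]]]; move/JS: Jy.
pose G := gen_ideal (A := tdata D') S'.
have iG : two_sided_ideal (A := tdata D') G.
  split=> [|a b Ga]; first exact: sG.
  split=> I iI SI; have [Iab Iba] := iI.2 a b (Ga I iI SI);
    [exact: Iab | exact: Iba].
(* The elements all of whose rescaled components lie in [G] form an ideal on the side of [D], and it
   contains [S]. All [v'] have to be taken at once, because multiplication by a word shifts
   multidegrees. *)
suff H : gen_ideal (A := tdata D) S y -> forall v', G (F (t_mdeg v' y)).
  by move=> Sy; exact: (H Sy v).
move/(_ (fun y => forall v', G (F (t_mdeg v' y)))); apply.
  split.
    split=> [u|k a b Ga Gb u]; first by rewrite (linear_map0 (scale_mdegL u));
      case: sG.
    by rewrite scale_mdegL; case: sG => _; apply; [apply: Ga | apply: Gb].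
  move=> a b Ga; split=> u; move: b; apply: malg_ind => [|w].
  - apply: submod_preim; last exact: sG.
    exact: (comp_linear (scale_mdegL u) (t_mulLr (dPhi D) (ddeg D) a)).
  - have := scale_mdeg_mulr tD (u - wmdeg w) a w; rewrite subrK -/(tw w).
    move/(congr1 (fun z => (q (u - wmdeg w) (wmdeg w) * c w) *: z)).
    rewrite scalerA divff ?scale1r;
      last by rewrite mulf_neq0 ?(tw_q0 tD) ?(tw_c0 tD).
    move=> <-; apply: (submodZ sG).
    have [Gl Gr] := iG.2 _ (tw w) (Ga (u - wmdeg w)).
    exact: Gl.
  - apply: submod_preim; last exact: sG.
    exact: (comp_linear (scale_mdegL u) (t_mulLl (dPhi D) (ddeg D) a)).
  - have := scale_mdeg_mull tD (u - wmdeg w) a w;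
      rewrite [wmdeg w + _]addrC subrK -/(tw w).
    move/(congr1 (fun z => (q (wmdeg w) (u - wmdeg w) * c w) *: z)).
    rewrite scalerA divff ?scale1r;
      last by rewrite mulf_neq0 ?(tw_q0 tD) ?(tw_c0 tD).
    move=> <-; apply: (submodZ sG).
    have [Gl Gr] := iG.2 _ (tw w) (Ga (u - wmdeg w)).
    exact: Gr.
move=> z Sz u I iI; apply; split.
  by apply: ideal_hull_incl; apply/JS => I' iI'; apply.
by have [r r2 rz] := S2 z Sz; exists r; rewrite // scale_mdeg_len rz.
Qed.

Lemma nichols_ideal_scale x :
  nichols_ideal (Phi := dPhi D) (d := ddeg D) (chi := dchi D) x ->
  nichols_ideal (Phi := dPhi D') (d := ddeg D') (chi := dchi D') (F x).
Proof.
apply: lspan_stable => [|| y [J aJ Jy]];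
  [exact: t_scaleL | exact: lspan_submod |].
have aJ' := @ideal_hull_admissible J aJ.
exact: (admissible_sub aJ' (t_scale_hull Jy)).
Qed.

End Ideals.

(** * The induced map of Nichols algebras *)

Section NicholsMap.
Variables (K : fieldType) (l : nat).
Implicit Types (D : yd_data K l) (c : seq 'I_l -> K).

Definition ndata D := nichols_hopf (dPhi D) (ddeg D) (dchi D).
Definition nproj D : talg K l -> ndata D :=
  @nichols_proj K _ (dPhi D) l (ddeg D) (dchi D).

Lemma nprojL D : linear (@nproj D).
Proof. exact: linearP. Qed.

Lemma nproj_surj D (x : ndata D) : exists X, x = nproj D X.
Proof. by exists (mrepr x); rewrite /nproj /nichols_proj mreprK. Qed.

Definition nichols_map D D' c (x : ndata D) : ndata D' :=
  nproj D' (t_scale c (mrepr x)).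

Lemma t_scale_comp c c' x : (forall w, c' w * c w = 1) ->
  t_scale c' (t_scale c x) = x.
Proof.
move=> cc; move: x; apply: malg_ext => [k x y|k x y|w] //.
  by rewrite !t_scaleL.
by rewrite -/(tword K w) t_scaleE (linear_mapZ (t_scaleL c')) t_scaleE scalerA
  mulrC cc scale1r.
Qed.

Lemma t_scale_coef c x w : (t_scale c x)@_w = c w * x@_w.
Proof.
move: x; apply: malg_ind => [|u].
  apply: (@submod_eq _ _ K^o (fun x => (t_scale c x)@_w) (fun x => c w * x@_w)).
    by move=> k x y; rewrite t_scaleL mcoeffD mcoeffZ.
  by move=> k x y; rewrite mcoeffD mcoeffZ mulrDr mulrCA.
rewrite -/(tword K u) t_scaleE /tword mcoeffZ mcoeffU.
by case: (eqVneq u w) => [->|_] //; rewrite !mulr0.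
Qed.

Section Map.
Variables (D D' : yd_data K l) (q : 'rV[int]_l -> 'rV[int]_l -> K)
  (c : seq 'I_l -> K).
Hypothesis tD : twisted D D' q c.
Local Notation f := (@nichols_map D D' c).

Lemma nichols_mapE X : f (nproj D X) = nproj D' (t_scale c X).
Proof.
apply/mproj_eq; have := nichols_ideal_scale tD
  (@nichols_repr K _ (dPhi D) l (ddeg D) (dchi D) X).
by rewrite (linear_mapB (t_scaleL c)); apply.
Qed.

Lemma nichols_map_linear : linear f.
Proof.
move=> k x y; have [X ->] := nproj_surj x; have [Y ->] := nproj_surj y.
apply: etrans (congr1 f (esym (nprojL D k X Y))) _.
apply: etrans (nichols_mapE _) _.
apply: etrans (congr1 (nproj D') (t_scaleL c k X Y)) _.
apply: etrans (nprojL D' _ _ _) _.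
by rewrite -(nichols_mapE X) -(nichols_mapE Y).
Qed.

Lemma nichols_map_gr v x : hgr v x -> hgr v (f x).
Proof.
case=> t tv ->; exists (t_scale c t); last exact: nichols_mapE.
move=> w; rewrite -mcoeff_neq0 t_scale_coef mulf_eq0 negb_or => /andP[_ tw].
by apply: tv; rewrite -mcoeff_neq0.
Qed.

End Map.

Lemma nichols_mapK D D' q c : twisted D D' q c ->
  cancel (@nichols_map D D' c) (@nichols_map D' D (fun w => (c w)^-1)).
Proof.
move=> tD x; have [X ->] := nproj_surj x.
rewrite (nichols_mapE tD) (nichols_mapE (twisted_sym tD)) t_scale_comp // => w.
by rewrite mulVf ?(tw_c0 tD).
Qed.

Lemma nichols_mapVK D D' q c : twisted D D' q c ->
  cancel (@nichols_map D' D (fun w => (c w)^-1)) (@nichols_map D D' c).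
Proof.
move=> tD x; have [X ->] := nproj_surj x.
rewrite (nichols_mapE (twisted_sym tD)) (nichols_mapE tD) t_scale_comp // => w.
by rewrite mulfV ?(tw_c0 tD).
Qed.

Lemma nichols_map_gr_iff D D' q c : twisted D D' q c ->
  forall v (x : ndata D), hgr v x <-> hgr v (@nichols_map D D' c x).
Proof.
move=> tD v x; split; first exact: (nichols_map_gr tD).
move=> h; have := @nichols_map_gr _ _ _ _ (twisted_sym tD) v _ h.
rewrite (nichols_mapK tD x); exact.
Qed.

End NicholsMap.

(** * Twisting by a cochain *)

Section TwistIso.
Variables (K : fieldType) (G H : finGroupType) (p : G -> H) (s : H -> G).
Hypotheses (pM : {morph p : x y / (x * y)%g}) (sK : cancel s p).
Hypothesis comm : forall x y : G, commute x y.
Variables (J : G -> G -> K) (Phi : H -> H -> H -> K).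
Hypothesis J2 : two_cochain J.
Hypothesis PhiJ : forall x y z, coboundary J x y z = Phi (p x) (p y) (p z).
Variables (l : nat) (d : 'I_l -> H) (chi : 'I_l -> H -> K).
Variables (d' : 'I_l -> G) (chi' : 'I_l -> G -> K).
Hypothesis dd' : forall i, p (d' i) = d i.
Hypothesis cc' : forall i g, chi i (p g) * J (d' i) g = J g (d' i) * chi' i g.

Local Notation Phi' := (trivial_cocycle K (G := G)).
Let D := YdData Phi d chi.
Let D' := YdData Phi' d' chi'.

Let J0 : forall g h, J g h != 0. Proof. by case: J2. Qed.
Let J1l : forall g, J 1%g g = 1. Proof. by case: J2. Qed.
Let J1r : forall g, J g 1%g = 1. Proof. by case: J2. Qed.

Fixpoint twist_coef (w : seq 'I_l) : K :=
  if w is i :: w' then J (d' i) (wdeg d' w') * twist_coef w' else 1.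

(** This is [J] read on multidegrees through a representative word, whose choice is immaterial by
    [twist_degE]. On vectors that are no multidegree the value is junk, but still nonzero, as
    [tw_q0] demands. *)
Definition twist_deg (u v : 'rV[int]_l) : K :=
  J (wdeg d' (wrep u)) (wdeg d' (wrep v)).

Lemma twist_degE u v :
  twist_deg (wmdeg u) (wmdeg v) = J (wdeg d' u) (wdeg d' v).
Proof. by rewrite /twist_deg; congr J; apply: wdeg_perm (wrepK _). Qed.

Lemma wdeg_proj w : p (wdeg d' w) = wdeg d w.
Proof.
elim: w => [|i w IH]; last by rewrite !wdeg_cons pM IH dd'.
by rewrite !wdeg_nil; apply: (mulgI (p 1%g)); rewrite -pM !mulg1.
Qed.

Lemma wcoef_trivial u v : wcoef Phi' d' u v = 1.
Proof. by elim: u => //= i u ->; rewrite invr1 mulr1. Qed.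

(** With $\eta_g(x)=J(x,g)/J(g,x)$ the right-hand side is $\eta_g(x)\eta_g(y)/\eta_g(xy)$: on $G$
    the 2-cocycle $\widetilde\Phi_g$ is the coboundary of $\eta_g$. This is why a correction by
    $\eta_g$ makes the projective actions linear. *)
Lemma tPhi_twist g x y : tPhi Phi (p g) (p x) (p y) =
  J g (x * y)%g * J y g * J x g / (J g x * J (x * y)%g g * J g y).
Proof.
rewrite /tPhi -!PhiJ /coboundary (comm y g) (comm x g).
by field; rewrite !J0.
Qed.

(** The factor [tPhi] in [wchar] is the defect of multiplicativity of $x\mapsto J(g,x)/J(x,g)$, so
    the relation assumed for generators passes to words. *)
Lemma wchar_twist g w :
  wchar Phi d chi (p g) w * J (wdeg d' w) g =
    J g (wdeg d' w) * wchar Phi' d' chi' g w.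
Proof.
elim: w => [|i w IH]; first by rewrite /= wdeg_nil J1l J1r.
rewrite /= wdeg_cons -dd' -wdeg_proj tPhi_twist.
have -> : wchar Phi d chi (p g) w =
  J g (wdeg d' w) * wchar Phi' d' chi' g w / J (wdeg d' w) g.
  by rewrite -IH mulfK.
have -> : chi i (p g) = J g (d' i) * chi' i g / J (d' i) g.
  by rewrite -cc' mulfK.
have -> : tPhi Phi' g (d' i) (wdeg d' w) = 1.
  by rewrite /tPhi /trivial_cocycle invr1 !mulr1.
by field; rewrite !J0.
Qed.

Lemma twist_twisted : twisted D D' twist_deg twist_coef.
Proof.
have c0 w : twist_coef w != 0.
  by elim: w => [|i w IH] /=; rewrite ?oner_eq0 // mulf_neq0.
have commH (x y : H) : commute x y.
  by rewrite /commute -(sK x) -(sK y) -!pM comm.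
have wmdeg0 : 0 = wmdeg ([::] : seq 'I_l) by rewrite wmdeg_nil.
split=> //=.
- by move=> u v; exact: J0.
- move=> v; rewrite /twist_deg wmdeg0.
  rewrite (wdeg_perm d' comm (wrepK [::])).
  by rewrite wdeg_nil J1l.
- move=> v; rewrite /twist_deg wmdeg0.
  rewrite (wdeg_perm d' comm (wrepK [::])).
  by rewrite wdeg_nil J1r.
- by move=> i w; rewrite twist_degE wdeg_cons wdeg_nil mulg1.
- move=> u v; rewrite wcoef_trivial mulr1 twist_degE.
  elim: u => [|i u IH]; first by rewrite /= wdeg_nil J1l mulr1.
  rewrite /= wdeg_cat wdeg_cons -dd' -!wdeg_proj -PhiJ /coboundary.
  transitivity ((J (wdeg d' u) (wdeg d' v) * J (d' i) (wdeg d' u * wdeg d' v) /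
     (J (d' i * wdeg d' u)%g (wdeg d' v) * J (d' i) (wdeg d' u)))^-1 *
    J (d' i) (wdeg d' u * wdeg d' v)%g *
      (wcoef Phi d u v * twist_coef (u ++ v))).
    by ring.
  by rewrite IH; field; rewrite !J0.
- by move=> u w; rewrite !twist_degE -wdeg_proj wchar_twist.
- move=> u1 u2 u3 u4; rewrite !twist_degE !wdeg_cat -!wdeg_proj /braid_coef.
  rewrite -!pM -!PhiJ /coboundary /trivial_cocycle !mulr1 invr1 mulr1.
  set a := wdeg d' u1; set b := wdeg d' u2.
  set c := wdeg d' u3; set e := wdeg d' u4.
  (* The braiding interchanges the two middle degrees; this is the only place where the products
     differ by more than associativity. *)
  rewrite !mulgA (comm c b).
  by field; rewrite !J0.
(* By [wchar_twist] the two characters differ by a ratio of values of [J] that depends on the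
   multidegree only. In the other direction below, [s e] serves as a preimage of [e]. *)
- move=> e; exists (p e), (fun v =>
    J (wdeg d' (wrep v)) e / J e (wdeg d' (wrep v))) => w.
  rewrite (wdeg_perm d' comm (wrepK w)) mulrAC [J _ e * _]mulrC wchar_twist.
  by rewrite mulrAC mulfV ?mul1r.
- move=> e; exists (s e), (fun v =>
    J (s e) (wdeg d' (wrep v)) / J (wdeg d' (wrep v)) (s e)) => w.
  rewrite (wdeg_perm d' comm (wrepK w)) mulrAC -wchar_twist sK.
  by rewrite mulfK.
- by move=> u v; apply: wdeg_perm.
- by move=> u v; apply: wdeg_perm.
Qed.

Local Notation F := (t_scale twist_coef).
Local Notation tw := (@tword K l).
Let tD := twist_twisted.

Lemma t_scale_mul x y : F (t_mul Phi d x y) =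
  \sum_g \sum_h J g h *: t_mul Phi' d' (t_deg d' g (F x)) (t_deg d' h (F y)).
Proof.
have FL := t_scaleL twist_coef.
move: x; apply: malg_ext => [||u].
- exact: (comp_linear FL (t_mulLl _ _ y)).
- do 2![apply: sum_linear => ?]; apply: scale_linear.
  exact: (comp_linear (t_mulLl Phi' d' _) (comp_linear (t_degL _ _) FL)).
move: y; apply: malg_ext => [||w].
- exact: (comp_linear FL (t_mulLr _ _ _)).
- do 2![apply: sum_linear => ?]; apply: scale_linear.
  exact: (comp_linear (t_mulLr Phi' d' _) (comp_linear (t_degL _ _) FL)).
rewrite -/(tw u) -/(tw w) !t_scaleE t_mulE (linear_mapZ FL) t_scaleE scalerA.
have degZ g v : t_deg d' g (twist_coef v *: tw v) =
    if wdeg d' v == g then twist_coef v *: tw v else 0.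
  rewrite (linear_mapZ (t_degL _ _)) t_degE; case: ifP => _ //; exact: scaler0.
rewrite (@big_only1 _ _ _ _ (wdeg d' u) xpredT _ isT) => [|g ne _]; last first.
  apply: big1 => h _.
  by rewrite degZ eq_sym (negPf ne) (linear_map0 (t_mulLl _ _ _)) scaler0.
rewrite (@big_only1 _ _ _ _ (wdeg d' w) xpredT _ isT) => [|g ne _]; last first.
  by rewrite (degZ g w) eq_sym (negPf ne) (linear_map0 (t_mulLr _ _ _)) scaler0.
rewrite !degZ !eqxx (linear_mapZ (t_mulLl _ _ _)) (linear_mapZ (t_mulLr _ _ _))
  t_mulE.
rewrite 3!scalerA; apply: scale_congr.
by rewrite (tw_mul tD) /= twist_degE !mulrA.
Qed.

Lemma t_scale_act e x : F (t_act Phi d chi (p e) x) =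
  \sum_h (J e h / J h e) *: t_act Phi' d' chi' e (t_deg d' h (F x)).
Proof.
have FL := t_scaleL twist_coef.
move: x; apply: malg_ext => [||w].
- exact: (comp_linear FL (t_actL _ _ _ _)).
- apply: sum_linear => ?; apply: scale_linear.
  exact: (comp_linear (t_actL Phi' d' _ _) (comp_linear (t_degL _ _) FL)).
rewrite -/(tw w) !t_scaleE t_actE (linear_mapZ FL) t_scaleE scalerA.
rewrite (@big_only1 _ _ _ _ (wdeg d' w) xpredT _ isT) => [|g ne _]; last first.
  rewrite (linear_mapZ (t_degL _ _)) t_degE eq_sym (negPf ne) scaler0.
  by rewrite (linear_map0 (t_actL _ _ _ _)) scaler0.
rewrite (linear_mapZ (t_degL _ _)) t_degE eqxx (linear_mapZ (t_actL _ _ _ _))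
  t_actE.
rewrite 2!scalerA; apply: scale_congr.
by rewrite -[wchar Phi d chi _ _](mulfK (J0 (wdeg d' w) e)) wchar_twist; ring.
Qed.

(** On words the intertwiner exceeds $F\otimes F$ by the factor [q], which is [J] of the two
    degrees; the inverse of [J] in the twisted coproduct cancels it. *)
Lemma t_scale_comul x : tens_map F F (t_comul Phi d chi x) =
  \sum_g \sum_h (J g h)^-1 *:
    tens_map (t_deg d' g) (t_deg d' h) (t_comul Phi' d' chi' (F x)).
Proof.
have FL := t_scaleL twist_coef.
have degL g h := tens_map_linear (t_degL d' g) (t_degL (K := K) d' h).
move: x; apply: malg_ext => [||w].
- exact: (comp_linear (tens_map_linear FL FL) (t_comulL _ _ _)).
- do 2![apply: sum_linear => ?]; apply: scale_linear.
  exact: (comp_linear (degL _ _) (comp_linear (t_comulL Phi' d' chi') FL)).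
rewrite -/(tw w) t_scaleE (linear_mapZ (t_comulL _ _ _)) -(tens_scale_comul tD).
have := @w_comul_homog _ _ D w.
set v := wmdeg w; move: (t_comul _ _ _ _) => t.
have sW : submod (fun t => tens_map F F t =
    \sum_g \sum_h (J g h)^-1 *:
      tens_map (t_deg d' g) (t_deg d' h) (tens_scale twist_deg twist_coef v t)).
  apply: submod_eq; first exact: (tens_map_linear FL FL).
  do 2![apply: sum_linear => ?]; apply: scale_linear.
  exact: (comp_linear (degL _ _) (tens_scaleL _ _ v)).
move=> /(_ _ sW); apply=> _ [u [u' [uu' ->]]].
rewrite tens_scaleE uu' eqxx (tens_mapE FL FL) !t_scaleE tpureZl tpureZr
  scalerA.
have degE g h k : tens_map (t_deg d' g) (t_deg d' h) (k *: (tw u \ox tw u')) =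
    if (wdeg d' u == g) && (wdeg d' u' == h) then k *: (tw u \ox tw u') else 0.
  rewrite (linear_mapZ (degL _ _)) (tens_mapE (t_degL _ _) (t_degL _ _))
    !t_degE.
  case: eqP => _ /=; last by rewrite tpure0l scaler0.
  by case: eqP => _ //; rewrite tpure0r scaler0.
rewrite (@big_only1 _ _ _ _ (wdeg d' u) xpredT _ isT) => [|g ne _]; last first.
  by apply: big1 => h _; rewrite degE eq_sym (negPf ne) scaler0.
rewrite (@big_only1 _ _ _ _ (wdeg d' u') xpredT _ isT) => [|g ne _]; last first.
  by rewrite degE andbC eq_sym (negPf ne) scaler0.
rewrite degE !eqxx scalerA; apply: scale_congr.
by rewrite twist_degE -!mulrA mulKf.
Qed.

End TwistIso.

(** * Operations on Nichols algebras and on their twists *)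

Section NicholsOps.
Variables (K : fieldType) (l : nat) (D : yd_data K l).
Local Notation T := (talg K l).
Local Notation N := (ndata D).

Lemma ndata_mulE X Y :
  hmul (nproj D X) (nproj D Y) = nproj D (dmul D X Y).
Proof. exact: (@nichols_mulE K _ (dPhi D) l (ddeg D) (dchi D) X Y). Qed.
Lemma ndata_degE g X : hdeg g (nproj D X) = nproj D (dproj D g X).
Proof. exact: (@nichols_degE K _ (dPhi D) l (ddeg D) (dchi D) g X). Qed.
Lemma ndata_actE g X : hact g (nproj D X) = nproj D (dact D g X).
Proof. exact: (@nichols_actE K _ (dPhi D) l (ddeg D) (dchi D) g X). Qed.
Lemma ndata_comulE X : hcomul (nproj D X) =
  tens_map (nproj D) (nproj D) (dcomul D X).
Proof. exact: (@nichols_comulE K _ (dPhi D) l (ddeg D) (dchi D) X). Qed.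

Lemma ndata_op_linear (f : N -> N) (f0 : T -> T) : linear f0 ->
  (forall X, f (nproj D X) = nproj D (f0 X)) -> linear f.
Proof.
move=> fL fE k x y; have [X ->] := nproj_surj x; have [Y ->] := nproj_surj y.
apply: etrans (congr1 f (esym (nprojL D k X Y))) _.
apply: etrans (fE _) _.
apply: etrans (congr1 (nproj D) (fL k X Y)) _.
apply: etrans (nprojL D _ _ _) _.
by rewrite -(fE X) -(fE Y).
Qed.

End NicholsOps.

Section TwistOps.
Variables (K : fieldType) (G : finGroupType) (J : G -> G -> K) (l : nat).
Variable A : ydHopf K G l.
Implicit Types x y : twist J A.

Lemma hmul_twist x y :
  hmul x y = \sum_g \sum_h J g h *: hmul (hdeg g (x : A)) (hdeg h (y : A)).
Proof. by []. Qed.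
Lemma hcomul_twist x : hcomul x =
  \sum_g \sum_h (J g h)^-1 *: tens_map (hdeg (y := A) g) (hdeg h)
    (hcomul (x : A)).
Proof. by []. Qed.
Lemma hact_twist g x :
  hact g x = \sum_h (J g h / J h g) *: hact g (hdeg h (x : A)).
Proof. by []. Qed.
Lemma hdeg_twist g x : hdeg g x = hdeg g (x : A).
Proof. by []. Qed.

End TwistOps.

(** * A Nichols algebra as a twist of a usual one *)

Section NicholsTwist.
Variables (K : fieldType) (G H : finGroupType) (p : G -> H) (s : H -> G).
Hypotheses (pM : {morph p : x y / (x * y)%g}) (sK : cancel s p).
Hypothesis comm : forall x y : G, commute x y.
Variables (J : G -> G -> K) (Phi : H -> H -> H -> K).
Hypothesis J2 : two_cochain J.
Hypothesis PhiJ : forall x y z, coboundary J x y z = Phi (p x) (p y) (p z).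
Variables (l : nat) (d : 'I_l -> H) (chi : 'I_l -> H -> K).
Variables (d' : 'I_l -> G) (chi' : 'I_l -> G -> K).
Hypothesis dd' : forall i, p (d' i) = d i.
Hypothesis cc' : forall i g, chi i (p g) * J (d' i) g = J g (d' i) * chi' i g.

Let D := YdData Phi d chi.
Let D' := YdData (trivial_cocycle K (G := G)) d' chi'.
Let tD : twisted D D' (twist_deg J d') (twist_coef J d') :=
  twist_twisted pM sK comm J2 PhiJ dd' cc'.
Let f : ndata D -> ndata D' := @nichols_map K l D D' (twist_coef J d').

Let fL : linear f. Proof. exact: (nichols_map_linear tD). Qed.
Let fE X : f (nproj D X) = nproj D' (t_scale (twist_coef J d') X).
Proof. exact: (nichols_mapE tD). Qed.

Lemma nichols_twist_mul x y :
  f (hmul x y) = hmul (f x : twist J (ndata D')) (f y).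
Proof.
have [X ->] := nproj_surj x; have [Y ->] := nproj_surj y.
rewrite (ndata_mulE D X Y) hmul_twist !fE
  (t_scale_mul pM sK comm J2 PhiJ dd' cc').
rewrite (linear_lincomb2 (nprojL D')); apply: eq_bigr => g _.
apply: eq_bigr => h _.
apply: (congr1 (fun z => J g h *: z)).
by rewrite !ndata_degE ndata_mulE.
Qed.

Lemma nichols_twist_comul x :
  hcomul (f x : twist J (ndata D')) = tens_map f f (hcomul x).
Proof.
have [X ->] := nproj_surj x.
have pL := nprojL D; have pL' := nprojL D'.
have FL := t_scaleL (twist_coef J d').
rewrite (ndata_comulE D X) hcomul_twist fE.
have lin4 := And4 pL fL FL pL'.
apply: etrans _ (esym (tens_map_square lin4 lin4 fE fE _)).
rewrite (t_scale_comul pM sK comm J2 PhiJ dd' cc').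
rewrite (linear_lincomb2 (tens_map_linear pL' pL')).
apply: eq_bigr => g _; apply: eq_bigr => h _.
apply: (congr1 (fun z => (J g h)^-1 *: z)).
have dL k := ndata_op_linear (t_degL d' k) (ndata_degE (D := D') k).
have lin4' k := And4 pL' (dL k) (t_degL (K := K) d' k) pL'.
rewrite (ndata_comulE D').
exact: (tens_map_square (lin4' g) (lin4' h) (ndata_degE (D := D') g)
  (ndata_degE (D := D') h)).
Qed.

Lemma nichols_twist_act e x :
  f (hact (p e) x) = hact e (f x : twist J (ndata D')).
Proof.
have [X ->] := nproj_surj x.
rewrite (ndata_actE (D := D)) hact_twist !fE
  (t_scale_act pM comm J2 PhiJ dd' cc').
rewrite (linear_lincomb (nprojL D')); apply: eq_bigr => g _.
apply: (congr1 (fun z => (J e g / J g e) *: z)).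
by rewrite !ndata_degE ndata_actE.
Qed.

Definition nichols_twist_map : {linear ndata D -> twist J (ndata D')} :=
  HB.pack_for {linear ndata D -> twist J (ndata D')} f
    (GRing.isLinear.Build _ _ _ _ f fL).

Lemma nichols_twist_iso : graded_hopf_iso nichols_twist_map.
Proof.
split.
- exact: (Bijective (nichols_mapK tD) (nichols_mapVK tD)).
- exact: (nichols_map_gr_iff tD).
- exact: nichols_twist_mul.
exact: nichols_twist_comul.
Qed.

(** In general the degree in [H] does not determine the degree in [G], so compatibility with the
    coactions depends on this hypothesis. It is immediate when [p] is the identity, the case of
    $\widetilde V$. *)
Lemma nichols_twist_deg g x :
  (forall w, (wdeg d' w == g) = (wdeg d w == p g)) ->
  f (hdeg (p g) x) = hdeg g (f x : twist J (ndata D')).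
Proof.
move=> dg; have [X ->] := nproj_surj x.
rewrite (ndata_degE (D := D)) hdeg_twist !fE ndata_degE; apply: congr1.
have FL := t_scaleL (twist_coef J d').
move: X; apply: malg_ext => [||w].
- exact: (comp_linear FL (t_degL _ _)).
- exact: (comp_linear (t_degL _ _) FL).
rewrite -/(tword K w) t_scaleE (linear_mapZ (t_degL _ _)) !t_degE /= dg.
by case: ifP => _; rewrite ?t_scaleE // (linear_map0 FL) scaler0.
Qed.

End NicholsTwist.

(** The map is $g^{-1}f$; each compatibility is checked after applying the injective [g], or
    $g\otimes g$ for the coproduct. *)
Lemma graded_hopf_iso_cospan (K : fieldType) (l : nat) (G1 G2 G3 : finGroupType)
    (A : ydHopf K G1 l) (B : ydHopf K G2 l) (C : ydHopf K G3 l)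
    (f : {linear A -> C}) (g : {linear B -> C}) :
  graded_hopf_iso f -> graded_hopf_iso g -> graded_hopf_isomorphic A B.
Proof.
case=> [[f' fK f'K] fgr fM fD] [[g' gK g'K] ggr gM gD].
have gL' : linear g' by move=> k x y; apply: (can_inj gK); rewrite linearP !g'K.
pose h x := g' (f x).
have hL : linear h by move=> k x y; rewrite /h linearP gL'.
have gh x : g (h x) = f x by rewrite /h g'K.
pose h' := HB.pack_for {linear A -> B} h (GRing.isLinear.Build _ _ _ _ h hL).
exists h'; split.
- exists (fun x => f' (g x)) => x; first by rewrite /= gh fK.
  by rewrite /= /h f'K gK.
- by move=> v x; rewrite fgr ggr /= gh.
- by move=> x y; apply: (can_inj gK); rewrite /= gh fM gM !gh.
move=> x; have gl : linear g by exact: linearP.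
have fl : linear f by exact: linearP.
have idl : linear (@id C) by [].
have ggK : cancel (tens_map g g) (tens_map g' g').
  apply: tens_ext => [||a b] //.
    exact: (comp_linear (tens_map_linear gL' gL') (tens_map_linear gl gl)).
  by rewrite !tens_mapE // !gK.
apply: (can_inj ggK).
have := gD (h x); rewrite gh fD => <-.
have lin4 := And4 hL gl fl idl.
apply: etrans _ (esym (tens_map_square lin4 lin4 gh gh _)).
move: (tens_map f f _); apply: tens_ext => [||a b]; first by [].
  exact: (tens_map_linear idl idl).
by rewrite tens_mapE.
Qed.

(** * Diagonal Yetter-Drinfeld modules *)

Section DiagonalYD.
Variables (K : fieldType) (G : finGroupType) (Phi : G -> G -> G -> K).
Variables (l : nat) (d : 'I_l -> G) (chi : 'I_l -> G -> K).
Hypothesis chi1 : forall i, chi i 1%g = 1.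
Hypothesis chiM : forall i e f,
  chi i e * chi i f = tPhi Phi (d i) e f * chi i (e * f)%g.
Local Notation V := 'rV[K]_l.
Implicit Type v : V.

Definition diag_end (k : 'I_l -> K) : 'End(V) :=
  linfun (mulmxr (diag_mx (\row_i k i))).

Lemma diag_endE k v i : diag_end k v 0 i = v 0 i * k i.
Proof. by rewrite lfunE /= mul_mx_diag !mxE. Qed.

Definition diag_pr (g : G) := diag_end (fun i => (d i == g)%:R).

Definition diag_comp (g : G) : {vspace V} := limg (diag_pr g).

Lemma diag_compP g v :
  reflect (forall i, d i != g -> v 0 i = 0) (v \in diag_comp g).
Proof.
apply: (iffP memv_imgP) => [[u _ ->] i ne|v0].
  by rewrite diag_endE (negPf ne) mulr0.
exists v; rewrite ?memvf //; apply/rowP => i; rewrite diag_endE.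
by case: (eqVneq (d i) g) => [_|/v0->]; rewrite ?mulr1 ?mul0r.
Qed.

Lemma diag_prE g h v :
  v \in diag_comp h -> diag_pr g v = if h == g then v else 0.
Proof.
move/diag_compP => v0; apply/rowP => i; rewrite diag_endE.
case: (eqVneq (d i) h) => [->|/v0 vi].
  by case: ifP; rewrite ?mulr1 // mulr0 mxE.
by rewrite vi mul0r; case: ifP; rewrite ?vi // mxE.
Qed.

Lemma diag_direct : directv (\sum_g diag_comp g)%VS.
Proof.
apply/directv_sum_independent => u uP u0 g _.
(* Projecting a vanishing sum onto degree [g] isolates its summand of index [g]. *)
have /(congr1 (diag_pr g)) := u0; rewrite linear0 linear_sum /= => <-.
rewrite (bigD1 g) //= big1 ?addr0 => [|h ne]; last first.
  by rewrite (diag_prE g (uP h isT)) (negPf ne).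
by rewrite (diag_prE g (uP g isT)) eqxx.
Qed.

Lemma diag_full : (\sum_g diag_comp g)%VS = fullv.
Proof.
apply/eqP; rewrite eqEsubv subvf; apply/subvP => v _.
have -> : v = \sum_g diag_pr g v.
  apply/rowP => i; rewrite summxE (bigD1 (d i)) //= diag_endE eqxx mulr1.
  rewrite big1 ?addr0 // => g; rewrite diag_endE eq_sym => /negPf ->.
  by rewrite mulr0.
by apply: memv_sumr => g _; rewrite memv_img ?memvf.
Qed.

Lemma diag_act_comp e g :
  (diag_end (chi^~ e) @: diag_comp g <= diag_comp g)%VS.
Proof.
apply/subvP => _ /memv_imgP[v /diag_compP v0 ->]; apply/diag_compP => i /v0 vi.
by rewrite diag_endE vi mul0r.
Qed.

Lemma diag_act1 v : diag_end (chi^~ 1%g) v = v.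
Proof. by apply/rowP => i; rewrite diag_endE chi1 mulr1. Qed.

Lemma diag_actM e f g v : v \in diag_comp g ->
  diag_end (chi^~ e) (diag_end (chi^~ f) v) =
  tPhi Phi g e f *: diag_end (chi^~ (e * f)%g) v.
Proof.
move/diag_compP => v0; apply/rowP => i; rewrite mxE !diag_endE.
case: (eqVneq (d i) g) => [<-|/v0->]; last by rewrite !mul0r mulr0.
by rewrite -mulrA [chi i f * _]mulrC chiM mulrCA.
Qed.

Definition diag_yd : ydMod Phi :=
  YdMod diag_direct diag_full diag_act_comp diag_act1 diag_actM.

Let vec (i : 'I_l) : diag_yd := delta_mx 0 i : V.

Lemma diag_vec_basis : basis_of fullv [tuple vec i | i < l].
Proof.
rewrite basisEdim size_tuple dimvf dim_matrix mul1r leqnn andbT.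
apply/subvP => v _; rewrite (row_sum_delta v); apply: memv_suml => i _.
by apply: memvZ; apply: memv_span; apply: map_f; rewrite mem_enum.
Qed.

Lemma diag_vec_homog i : vec i \in yd_comp diag_yd (d i).
Proof.
apply/diag_compP => j; rewrite mxE eqxx /=.
by case: (eqVneq j i) => // ->; rewrite eqxx.
Qed.

Lemma diag_vec_act i e : yd_act diag_yd e (vec i) = chi i e *: vec i.
Proof.
apply/rowP => j; rewrite diag_endE !mxE eqxx /= mulrC.
by case: (eqVneq j i) => [->|_]; rewrite ?mulr0.
Qed.

Definition diag_basis : canonical_basis diag_yd l :=
  CanonicalBasis diag_vec_basis diag_vec_homog diag_vec_act.

End DiagonalYD.

Section CanonicalBasisChar.
Variables (K : fieldType) (H : finGroupType) (Phi : H -> H -> H -> K).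
Variables (V : ydMod Phi) (l : nat) (X : canonical_basis V l).

Lemma cb_vec_neq0 i : cb_vec X i != 0.
Proof.
apply: (free_not0 (basis_free (cb_basis X))).
by apply: map_f; rewrite mem_enum.
Qed.

Lemma cb_char1 i : cb_char X i 1%g = 1.
Proof.
have := cb_act X i 1%g; rewrite yd_act1 -[LHS]scale1r => /eqP.
rewrite -subr_eq0 -scalerBl scaler_eq0 (negPf (cb_vec_neq0 i)) orbF.
by rewrite subr_eq0 => /eqP.
Qed.

Lemma cb_charM i e f : cb_char X i e * cb_char X i f =
  tPhi Phi (cb_deg X i) e f * cb_char X i (e * f)%g.
Proof.
have := yd_actM e f (cb_homog X i);
  rewrite !(cb_act X, linearZ) /= cb_act !scalerA => /eqP.
rewrite -subr_eq0 -scalerBl scaler_eq0 (negPf (cb_vec_neq0 i)) orbF.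
by rewrite subr_eq0 => /eqP E; rewrite [LHS]mulrC E mulrC.
Qed.

End CanonicalBasisChar.

(** * Untwisting the pulled back module *)

Section PullbackTwist.
Variables (K : fieldType) (G H : finGroupType) (p : G -> H) (s : H -> G).
Hypotheses (pM : {morph p : x y / (x * y)%g}) (sK : cancel s p).
Hypothesis comm : forall x y : G, commute x y.
Variables (Phi : H -> H -> H -> K) (J : G -> G -> K).
Hypothesis J2 : two_cochain J.
Hypothesis PhiJ : forall x y z, coboundary J x y z = pullback Phi p x y z.
Variables (V : ydMod Phi) (l : nat) (X : canonical_basis V l).

Let d' i := s (cb_deg X i).
Let chi' i g := J (d' i) g / J g (d' i) * cb_char X i (p g).

Let J0 : forall g h, J g h != 0. Proof. by case: J2. Qed.

Let p1 : p 1%g = 1%g.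
Proof. by apply: (mulgI (p 1%g)); rewrite -pM !mulg1. Qed.

Lemma untwist_char1 i : chi' i 1%g = 1.
Proof. by case: J2 => _ Jl Jr; rewrite /chi' p1 cb_char1 Jl Jr divr1 mulr1. Qed.

(** By [tPhi_twist] the projective defect of [cb_char] is a coboundary, and the ratio of values of
    [J] in [chi'] removes exactly that coboundary. *)
Lemma untwist_charM i e f : chi' i e * chi' i f =
  tPhi (trivial_cocycle K (G := G)) (d' i) e f * chi' i (e * f)%g.
Proof.
have := cb_charM X i (p e) (p f); rewrite -pM /chi' -{1}(sK (cb_deg X i)).
rewrite (tPhi_twist (p := p) (Phi := Phi) comm J2 PhiJ) -/(d' i) => E.
rewrite /tPhi /trivial_cocycle invr1 !mulr1 mul1r mulrACA E.
by field; rewrite !J0.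
Qed.

Definition untwist_yd : ydMod (trivial_cocycle K (G := G)) :=
  diag_yd untwist_char1 untwist_charM.

Definition untwist_basis : canonical_basis untwist_yd l :=
  diag_basis untwist_char1 untwist_charM.

Let idM : {morph (@id G) : x y / (x * y)%g}. Proof. by []. Qed.
Let idK : cancel (@id G) (@id G). Proof. by []. Qed.

(* B(V) and B(\widetilde V) are both isomorphic to the same twist of a usual
   Nichols algebra, whence the first conclusion. *)
Lemma pullback_twist_equivalent :
  graded_hopf_isomorphic (nichols (pull_basis pM sK X)) (nichols X) /\
  twist_equivalent_to_usual (pullback Phi p) (nichols (pull_basis pM sK X)).
Proof.
have cc i g : cb_char X i (p g) * J (d' i) g = J g (d' i) * chi' i g.
  by rewrite /chi' mulrA mulrCA mulfV // mulr1 mulrC.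
have dd i : p (d' i) = cb_deg X i by exact: sK.
have iso1 := nichols_twist_iso (Phi := Phi) pM sK comm J2 PhiJ dd cc.
(* $\widetilde V$ already lives over $G$, so the identity plays the part of [p]; [d'] and [chi'] are
   those of [iso1], and hence so is the target. *)
have iso2 := nichols_twist_iso (p := id) (s := id) (Phi := pullback Phi p)
  (d := d') (chi := fun i g => cb_char X i (p g))
  idM idK comm J2 PhiJ (fun i => erefl) cc.
split; first exact: graded_hopf_iso_cospan iso2 iso1.
exists J; split=> //; exists untwist_yd, untwist_basis.
eexists; split; first exact: iso2.
  move=> g x.
  exact: (nichols_twist_deg (p := id) (s := id) (Phi := pullback Phi p)
    (d := d') (chi := fun i g => cb_char X i (p g))
    idM idK comm J2 PhiJ (fun i => erefl) cc).
move=> g x.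
exact: (nichols_twist_act (p := id) (s := id) (Phi := pullback Phi p)
  (d := d') (chi := fun i g => cb_char X i (p g))
  idM idK comm J2 PhiJ (fun i => erefl) cc).
Qed.

End PullbackTwist.

(** * Trivialization of the pulled back cocycle *)

Section CoboundaryProducts.
Variables (K : fieldType) (G : finGroupType).

Lemma coboundaryM (A B : G -> G -> K) x y z :
  coboundary (fun x y => A x y * B x y) x y z =
  coboundary A x y z * coboundary B x y z.
Proof. by rewrite /coboundary !invfM; ring. Qed.

Lemma coboundary_prod (I : finType) (P : pred I) (F : I -> G -> G -> K) x y z :
  coboundary (fun x y => \prod_(i | P i) F i x y) x y z =
  \prod_(i | P i) coboundary (F i) x y z.
Proof. by rewrite /coboundary prodf_div !big_split. Qed.

End CoboundaryProducts.

Section AbelianCocycle.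
Variables (n : nat) (m : 'I_n -> nat) (m_gt0 : forall i : 'I_n, (0 < m i)%N).
Local Notation G := (zprod (msq m)).

Lemma msqK i : (msq m i).-1.+1 = (m i ^ 2)%N.
Proof. by rewrite prednK // expn_gt0 m_gt0. Qed.

Lemma zprod_mulE (x y : G) i :
  (x * y)%g i = ((x i + y i) %% (m i ^ 2))%N :> nat.
Proof. by rewrite !ffunE /=; congr (_ %% _)%N; exact: msqK. Qed.

Lemma zproj_val (x : G) i : zproj x i = (x i %% m i)%N :> nat.
Proof. by rewrite ffunE /=; congr (_ %% _)%N; exact: prednK. Qed.

Lemma zprod_comm (x y : G) : commute x y.
Proof.
by apply/ffunP => i; apply: val_inj; rewrite /= !zprod_mulE addnC.
Qed.

Variables (K : fieldType).

(* To be used with z ^+ m s = zeta_{m t}^-1. The coboundary produces the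
   exponent k x_t (y' + w' - (y' + w') mod m_s) = k x_t m_s [(y' + w') / m_s],
   where y' and w' are the residues of y_s and w_s modulo m_s. *)
Definition cochain_factor (z : K) (k : nat) (s t : 'I_n) (x y : G) : K :=
  z ^+ (k * x t * (y s %% m s)).

Lemma coboundary_factor (z zeta : K) (k : nat) (s t : 'I_n) (x y w : G) :
  (m s %| m t)%N -> z != 0 -> zeta ^+ m t = 1 -> z ^+ m s = zeta^-1 ->
  coboundary (cochain_factor z k s t) x y w =
  zeta ^+ (k * zproj x t * ((zproj y s + zproj w s) %/ m s)).
Proof.
move=> mst z0 zt zs.
(* This is where the squared orders enter: the reduction of [x t + y t] modulo [m t ^ 2] in the
   group law leaves powers of [z] unchanged. *)
have z1 : z ^+ (m t ^ 2) = 1.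
  apply: (@expr_dvd K (m s * m t)%N); first by rewrite exprM zs exprVn zt invr1.
  by rewrite dvdn_mul.
have mod_expr (x0 : K) M u r : x0 ^+ M = 1 ->
    x0 ^+ (k * (u %% M) * r) = x0 ^+ (k * u * r).
  move=> xM; rewrite (mulnAC k (u %% M)%N) (mulnAC k u) exprM.
  rewrite expr_mod -?exprM //.
  by rewrite mulnC exprM xM expr1n.
rewrite /coboundary /cochain_factor !zprod_mulE !zproj_val !mod_expr //.
(* The second argument of the cochain matters modulo [m s] only, so reduction modulo [m s ^ 2] in
   the group law is harmless there. *)
have dm2 : (m s %| m s ^ 2)%N by rewrite dvdn_exp.
rewrite modn_dvdm // -modnDm.
set y' := (y s %% m s)%N; set w' := (w s %% m s)%N.
have E := divn_eq (y' + w') (m s).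
move: (_ %/ _)%N (_ %% _)%N E => Q R E.
apply: (mulIf (_ : z ^+ (k * (x t + y t) * w') * z ^+ (k * x t * y') != 0)).
  by rewrite mulf_neq0 ?expf_neq0.
rewrite divfK; last by rewrite mulf_neq0 ?expf_neq0.
have -> : z ^+ (k * (x t + y t) * w') * z ^+ (k * x t * y') =
    z ^+ (k * y t * w') * z ^+ (k * x t * R) * (zeta^-1) ^+ (k * x t * Q).
  rewrite -zs -exprM -!exprD; congr (z ^+ _).
  transitivity (k * y t * w' + k * x t * (y' + w'))%N; first by ring.
  by rewrite E; ring.
by rewrite mulrCA exprVn mulfV ?mulr1 // expf_neq0 // -invr_eq0 -zs expf_neq0.
Qed.

End AbelianCocycle.

Lemma closed_nth_root (K : closedFieldType) (k : nat) (c : K) :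
  (0 < k)%N -> exists z, z ^+ k == c.
Proof.
move=> k0; have [|z /rootP] := closed_rootP ('X^k - c%:P) _.
  by rewrite size_XnsubC // -lt0n.
by rewrite !hornerE => /eqP; rewrite subr_eq0; exists z.
Qed.

Lemma dvdn_chain (n : nat) (m : 'I_n -> nat) :
  (forall i j : 'I_n, j = i.+1 :> nat -> (m i %| m j)%N) ->
  forall i j : 'I_n, (i <= j)%N -> (m i %| m j)%N.
Proof.
move=> mS i j /subnKC; move: (j - i)%N => k; elim: k j => [|k IH] j ij.
  by have -> : i = j by apply: val_inj; rewrite /= -ij addn0.
have kn : (i + k < n)%N by apply: leq_trans (ltn_ord j); rewrite -ij addnS.
apply: (dvdn_trans (IH (Ordinal kn) erefl)).
by apply: mS; rewrite /= -ij addnS.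
Qed.

Section Trivialization.
Variables (K : fieldType) (n : nat) (m : 'I_n -> nat).
Hypothesis m_gt0 : forall i : 'I_n, (0 < m i)%N.
Variables (z : 'I_n -> 'I_n -> K) (a : 'I_n -> nat) (b : 'I_n -> 'I_n -> nat).

(** One family of roots serves both products: the diagonal entries [z i i] are the $\xi_i^{-1}$, and
    [z s t] with [s < t] are the $\xi_{st}^{-1}$. *)
Definition abelian_cochain (x y : zprod (msq m)) : K :=
  (\prod_(i < n) cochain_factor (z i i) (a i) i i x y) *
  (\prod_(s < n) \prod_(t < n | (s < t)%N)
     cochain_factor (z s t) (b s t) s t x y).

Lemma abelian_cochain_two_cochain :
  (forall s t, z s t != 0) -> two_cochain abelian_cochain.
Proof.
move=> z0.
have f1l s t k (y : zprod (msq m)) : cochain_factor (z s t) k s t 1%g y = 1.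
  by rewrite /cochain_factor !ffunE /= muln0 mul0n.
have f1r s t k (x : zprod (msq m)) : cochain_factor (z s t) k s t x 1%g = 1.
  by rewrite /cochain_factor !ffunE /= mod0n muln0.
split=> [x y|y|x].
- rewrite mulf_neq0 //; first by apply/prodf_neq0 => i _; rewrite expf_neq0.
  by apply/prodf_neq0 => s _; apply/prodf_neq0 => t _; rewrite expf_neq0.
- by rewrite /abelian_cochain !big1 ?mulr1 // => s _; rewrite ?big1.
by rewrite /abelian_cochain !big1 ?mulr1 // => s _; rewrite ?big1.
Qed.

Lemma coboundary_abelian_cochain (zeta : nat -> K) :
  (forall s t : 'I_n, (s <= t)%N -> (m s %| m t)%N) ->
  (forall i, zeta (m i) ^+ m i = 1) ->
  (forall s t, z s t != 0) ->
  (forall s t, z s t ^+ m s = (zeta (m t))^-1) ->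
  forall x y w, coboundary abelian_cochain x y w =
    pullback (abelian_cocycle zeta (m := m) a b) (@zproj n m) x y w.
Proof.
move=> m_le zeta1 z0 zm x y w; rewrite coboundaryM !coboundary_prod.
congr (_ * _); apply: eq_bigr => s _;
  first by rewrite (coboundary_factor _ (zeta := zeta (m s))) ?dvdnn.
rewrite coboundary_prod; apply: eq_bigr => t st.
by rewrite (coboundary_factor _ (zeta := zeta (m t))) // m_le // ltnW.
Qed.

End Trivialization.

Theorem proposition4p7
    (K : closedFieldType) (charK : [pchar K] =i pred0)
    (zeta : nat -> K)
    (zetaP : forall k : nat, (0 < k)%N -> k.-primitive_root (zeta k))
    (n : nat) (m : 'I_n -> nat)
    (m_gt0 : forall i : 'I_n, (0 < m i)%N)
    (m_dvd : forall i j : 'I_n, j = i.+1 :> nat -> (m i %| m j)%N)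
    (a : 'I_n -> nat) (a_lt : forall i : 'I_n, (a i < m i)%N)
    (b : 'I_n -> 'I_n -> nat)
    (b_lt : forall s t : 'I_n, (s < t)%N -> (b s t < gcdn (m s) (m t))%N)
    (V : ydMod (@abelian_cocycle K zeta n m a b))
    (l : nat) (X : canonical_basis V l)
    (suppX : support_group X = [set: zprod m]) :
  graded_hopf_isomorphic (nichols (tilde_basis X)) (nichols X) /\
  twist_equivalent_to_usual
    (pullback (@abelian_cocycle K zeta n m a b) (@zproj n m))
    (nichols (tilde_basis X)).
Proof.
have zeta1 i : zeta (m i) ^+ m i = 1 by apply: prim_expr_order; apply: zetaP.
have zeta0 i : zeta (m i) != 0.
  by apply: contra_eq_neq (zeta1 i) => ->;
    rewrite expr0n gtn_eqF ?m_gt0 // eq_sym oner_eq0.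
(* Any root will do. The inverse is taken so that the carry, which enters the coboundary with a
   negative exponent, comes out as a power of [zeta (m t)] itself. *)
pose z s t := xchoose (closed_nth_root (zeta (m t))^-1 (m_gt0 s)).
have zm s t : z s t ^+ m s =
  (zeta (m t))^-1 by apply/eqP/(xchooseP (closed_nth_root _ _)).
have z0 s t : z s t != 0.
  have : z s t ^+ m s != 0 by rewrite zm invr_eq0.
  by rewrite expf_eq0 m_gt0.
have PhiJ := coboundary_abelian_cochain m_gt0 a b (dvdn_chain m_dvd) zeta1 z0
  zm.
have J2 := abelian_cochain_two_cochain m a b z0.
exact: (pullback_twist_equivalent (@zprojM n m) (@zsecK n m) (zprod_comm m_gt0)
  J2 PhiJ X).
Qed.
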